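(* Let $\beta$ be a real number with $\beta\notin\mathbb{Z}$ and let $x$ be a nonzero real number. Then, for $\alpha=1$, the following reduction formula holds true: $$\left.\frac{\partial \mathrm{Wi}_{\alpha,\beta}(x)}{\partial\alpha}\right|_{\alpha=1}=\frac{\psi(\beta)}{\Gamma(\beta)}-x^{(1-\beta)/2}I_{\beta-1}(2\sqrt x)\left[\psi(\beta)+\frac{x}{\beta(\beta-1)}\,{}_3F_4\left(1,1,\tfrac32;\,2,2,1+\beta,1+\beta;\,4x\right)\right]$$ $$-\frac{\Gamma(1-\beta)}{\beta\,\Gamma(1+\beta)}\,x^{(1+\beta)/2}I_{1-\beta}(2\sqrt x)\,{}_2F_3\left(\beta,\tfrac12+\beta;\,2\beta,1+\beta,1+\beta;\,4x\right).$$
   Context: The integral Wright function is $\mathrm{Wi}_{\alpha,\beta}(x)=\sum_{k=1}^\infty\frac{x^k}{k\,k!\,\Gamma(\alpha k+\beta)}$, so that $\frac{\partial \mathrm{Wi}_{\alpha,\beta}(x)}{\partial\alpha}=-\sum_{k=1}^\infty\frac{\psi(\alpha k+\beta)}{k!\,\Gamma(\alpha k+\beta)}x^k$. Here $\psi(z)=\Gamma'(z)/\Gamma(z)$ is the digamma function, $I_\nu$ is the modified Bessel function of the first kind, and ${}_pF_q(a_1,\dots,a_p;b_1,\dots,b_q;z)$ is the generalized hypergeometric function with upper parameters $a_i$ and lower parameters $b_j$.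
   Formalization: The last lower parameter of the 3F4 is 2−β instead of the second 1+β (the printed formula fails unless β=1/2); when 2β is a negative odd integer, the 2F3, undefined as written, is read as its limit in β. *)

(* Defs.v *)
(* Stdlib reals with Coquelicot. *)
From Stdlib Require Export Reals Factorial List.
From Stdlib Require Import ClassicalEpsilon.
From Coquelicot Require Export Coquelicot.
Export ListNotations.
Open Scope R_scope.

Fixpoint poch (a : R) (k : nat) : R :=
  match k with
  | O => 1
  | S j => poch a j * (a + INR j)
  end.

(* Euler-Gauss limit n! n^z / (z (z + 1) ... (z + n)), which is Gamma(z) for
   every real z that is not a pole.  At the poles 0, -1, -2, ... the conventions
   of [Rinv] give [Gamma z = 0], hence [/ Gamma z = 0]: this is the right value
   of the entire function 1/Gamma, so the series below that divide by [Gamma]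
   need no exception there. *)
Definition Gamma (z : R) : R :=
  real (Lim_seq (fun n => INR (fact n) * Rpower (INR n) z / poch z (S n))).

Definition digamma (z : R) : R := Derive Gamma z / Gamma z.

(* Summation over k >= 1, with k = S n. *)
Definition Wi (alpha beta x : R) : R :=
  Series (fun n => x ^ S n /
    (INR (S n) * INR (fact (S n)) * Gamma (alpha * INR (S n) + beta))).

Definition poch_prod (l : list R) (k : nat) : R :=
  fold_right (fun a p => poch a k * p) 1 l.

Definition pFq (a b : list R) (z : R) : R :=
  Series (fun k => poch_prod a k / poch_prod b k * (z ^ k / INR (fact k))).

Definition nonpos_int (c : R) : Prop := exists n : nat, c = - INR n.

(* A hypergeometric function whose parameters depend on [t].  Where some lower
   parameter is a nonpositive integer, [pFq] is undefined and the value is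
   the continuous extension in [t].  For upper parameters t, 1/2 + t and lower
   parameters 2 t, 1 + t, 1 + t this happens at t = -1/2, -3/2, ..., where
   (t)_k (1/2 + t)_k / (2 t)_k = (2 t + k)_k / 4^k has removable singularities;
   the other convention, truncating the series at the first zero of
   (1/2 + t)_k, gives a different number. *)
Definition pFq_at (a b : R -> list R) (t z : R) : R :=
  if excluded_middle_informative (Exists nonpos_int (b t))
  then real (Lim (fun s => pFq (a s) (b s) z) t)
  else pFq (a t) (b t) z.

(* Principal argument, in (-PI, PI]. *)
Definition Carg (z : C) : R :=
  if Rlt_dec (Im z) 0 then - acos (Re z / Cmod z) else acos (Re z / Cmod z).

(* Principal branch of z^s, for z <> 0 and real s. *)
Definition Cpower (z : C) (s : R) : C :=
  (RtoC (Rpower (Cmod z) s) * (cos (s * Carg z), sin (s * Carg z)))%C.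

Definition Csqrt (z : C) : C := Cpower z (1 / 2).

Definition CSeries (u : nat -> C) : C :=
  (Series (fun k => Re (u k)), Series (fun k => Im (u k))).

Definition besselI (nu : R) (z : C) : C :=
  (Cpower (z / 2) nu *
   CSeries (fun k =>
     (z * z / 4) ^ k / RtoC (INR (fact k) * Gamma (nu + INR k + 1))))%C.

(* Main.v *)
Require Import Defs.
From Stdlib Require Import Lra Lia ClassicalEpsilon.

(** Differentiating the series of Wi term by term gives, with the Pochhammer
    symbol (beta)_k and H_k = sum_(j < k) 1 / (beta + j),
      d Wi / d alpha = psi(beta) / Gamma(beta)
        - (psi(beta) a(x) + h(x)) / Gamma(beta)     at alpha = 1,
    where a = 0F1(; beta; x) = sum x^k / (k! (beta)_k) and
    h = sum H_k x^k / (k! (beta)_k), because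
    Gamma(beta + k) = (beta)_k Gamma(beta) and psi(beta + k) = psi(beta) + H_k
    ([Derive_Wi]).  Everything is thus reduced to the evaluation of h, an identity
    between power series whose coefficients are rational in beta.

    Up to sign, h is the derivative of a with respect to the parameter, so it
    solves the inhomogeneous Bessel-type equation x h'' + beta h' - h = a'.  The
    homogeneous equation has the solutions a and x^(1 - beta) b, where
    b = 0F1(; 2 - beta; x), and variation of parameters yields h = a P + b Q with
      (beta - 1) P' = b a',   (1 - beta) (x Q' + (beta - 1) Q) = x a a'
    ([harmonic_variation_of_parameters]).  The Wronskian of the two homogeneous
    solutions is an explicit constant multiple of x^(-beta) ([wronskian]).

    The products b a' and a a' are again hypergeometric: by the Chu-Vandermonde
    convolution a product of two 0F1 series has closed-form coefficients
    ([hyp0F1_mult]).  Integrating term by term, P and Q are constant multiples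
    of x times the 3F4 and the 2F3 of the formula ([PSeries_coefP],
    [PSeries_coefQ]).  When 2 beta is a nonpositive
    integer the 2F3 is a limit in its parameter, and its simplified coefficients
    are continuous there and uniformly dominated ([pFq_at_coef2F3]).

    The Gamma function is given by the limit of Euler and Gauss.  For z > 0 its
    logarithm is a series whose terms have derivatives of order
    1 / j^2, which gives convergence and differentiability; the functional
    equation carries both to the negative nonintegers, and bounds psi / Gamma on
    [2, oo), which justifies differentiating Wi termwise.  The three interchanges
    of limit and sum all come from dominated convergence ([tannery]).

    For the branches, x = |x| exp(i phi) with phi in {0, PI}, and the arguments of
    x and of its square root stay in [0, PI]; so the principal powers multiply
    without phase jump, and x^((1 - beta) / 2) I_(beta - 1)(2 sqrt x) and
    x^((1 + beta) / 2) I_(1 - beta)(2 sqrt x) are the real numbers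
    a(x) / Gamma(beta) and x b(x) / Gamma(2 - beta). *)

(** * Entire series and the Euler operator *)

(** The summable-for-every-argument form makes all closure properties instances of
    comparison. *)
Definition entire (c : nat -> R) : Prop := forall t, CV_disk c t.

(** The Euler operator x d/dx, read on coefficients. Unlike d/dx it does not shift
    indices, so differential equations become coefficientwise relations, and no
    differentiability has to be discussed. *)
Definition theta (c : nat -> R) (n : nat) : R := INR n * c n.

Lemma ex_series_dominated (u v : nat -> R) :
  (forall n, Rabs (u n) <= v n) -> ex_series v -> ex_series u.
Proof.
  intros H Hv.
  exact (@ex_series_le R_AbsRing R_CompleteNormedModule u v H Hv).
Qed.

Lemma entire_dominated (c d : nat -> R) (K : R) :
  (forall n, Rabs (c n) <= K * Rabs (d n)) -> entire d -> entire c.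
Proof.
  intros H Hd t.
  apply ex_series_dominated with (v := fun n => K * Rabs (d n * t ^ n)).
  - intros n. rewrite Rabs_Rabsolu, !Rabs_mult, <- Rmult_assoc.
    apply Rmult_le_compat_r; [apply Rabs_pos | apply H].
  - apply (ex_series_scal_l K (fun n => Rabs (d n * t ^ n))). apply Hd.
Qed.

Lemma entire_radius (c : nat -> R) (t : R) :
  entire c -> Rbar_lt t (CV_radius c).
Proof.
  intros H. apply Rbar_lt_le_trans with (t + 1); [simpl; lra |].
  apply (Lub_Rbar_correct (CV_disk c)). apply H.
Qed.

Lemma entire_ex_pseries (c : nat -> R) (t : R) : entire c -> ex_pseries c t.
Proof. intros H. apply CV_disk_correct, H. Qed.

Lemma entire_ex_series (c : nat -> R) (t : R) :
  entire c -> ex_series (fun n => c n * t ^ n).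
Proof. intros H. apply ex_series_Rabs, H. Qed.

Lemma entire_exp (r : R) : entire (fun n => r ^ n / INR (fact n)).
Proof.
  intros t.
  apply ex_series_ext with (fun n => Rabs (r * t) ^ n / INR (fact n)).
  - intros n. unfold Rdiv.
    rewrite RPow_abs, Rpow_mult_distr, !Rabs_mult, (Rabs_pos_eq (/ _)); [simpl; ring |].
    left. apply Rinv_0_lt_compat, INR_fact_lt_0.
  - exists (exp (Rabs (r * t))).
    apply (is_series_ext (fun n => scal (pow_n (Rabs (r * t)) n) (/ INR (fact n)))).
    + intros n. rewrite pow_n_pow. reflexivity.
    + apply is_exp_Reals.
Qed.

Lemma entire_plus (c d : nat -> R) :
  entire c -> entire d -> entire (PS_plus c d).
Proof.
  intros Hc Hd t.
  apply ex_series_dominated with (v := fun n => Rabs (c n * t ^ n) + Rabs (d n * t ^ n)).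
  - intros n. rewrite Rabs_Rabsolu. unfold PS_plus, plus; simpl.
    rewrite Rmult_plus_distr_r. apply Rabs_triang.
  - apply (ex_series_plus (fun n => Rabs (c n * t ^ n)) (fun n => Rabs (d n * t ^ n)));
      [apply Hc | apply Hd].
Qed.

Lemma entire_scal (k : R) (c : nat -> R) : entire c -> entire (PS_scal k c).
Proof.
  apply entire_dominated with (K := Rabs k).
  intros n. unfold PS_scal, scal; simpl. unfold mult; simpl. rewrite Rabs_mult. lra.
Qed.

(** Since n <= 2^n, the factor n costs at most a doubling of the argument. *)
Lemma entire_theta (c : nat -> R) : entire c -> entire (theta c).
Proof.
  intros Hc t.
  apply ex_series_dominated with (v := fun n => Rabs (c n * (2 * t) ^ n)); [| apply Hc].
  intros n. unfold theta. rewrite Rabs_Rabsolu, Rpow_mult_distr, !Rabs_mult.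
  rewrite (Rabs_pos_eq (INR n)) by apply pos_INR.
  rewrite (Rabs_pos_eq (2 ^ n)) by (apply pow_le; lra).
  assert (H : INR n <= 2 ^ n).
  { induction n as [|n IH]; [simpl; lra |].
    rewrite S_INR. simpl. pose proof (pow_R1_Rle 2 n ltac:(lra)). lra. }
  pose proof (Rabs_pos (c n)). pose proof (Rabs_pos (t ^ n)).
  replace (INR n * Rabs (c n) * Rabs (t ^ n))
    with (INR n * (Rabs (c n) * Rabs (t ^ n))) by ring.
  replace (Rabs (c n) * (2 ^ n * Rabs (t ^ n)))
    with (2 ^ n * (Rabs (c n) * Rabs (t ^ n))) by ring.
  apply Rmult_le_compat_r; [| exact H]. now apply Rmult_le_pos.
Qed.

Lemma entire_incr (c : nat -> R) : entire c -> entire (PS_incr_1 c).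
Proof.
  intros Hc t. apply (ex_series_incr_1 (fun n => Rabs (PS_incr_1 c n * t ^ n))).
  apply ex_series_ext with (fun n => Rabs t * Rabs (c n * t ^ n)).
  - intros n. simpl. rewrite <- Rabs_mult. f_equal. ring.
  - apply (ex_series_scal_l (Rabs t) (fun n => Rabs (c n * t ^ n))), Hc.
Qed.

Lemma PS_mult_pow (c d : nat -> R) (t : R) (n : nat) :
  PS_mult c d n * t ^ n = PS_mult (fun k => c k * t ^ k) (fun k => d k * t ^ k) n.
Proof.
  unfold PS_mult. rewrite Rmult_comm, scal_sum. apply sum_eq. intros i Hi.
  replace (t ^ n) with (t ^ i * t ^ (n - i)) by (rewrite <- pow_add; f_equal; lia).
  ring.
Qed.

Lemma Rabs_PS_mult_le (c d : nat -> R) (n : nat) :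
  Rabs (PS_mult c d n) <= PS_mult (fun k => Rabs (c k)) (fun k => Rabs (d k)) n.
Proof.
  unfold PS_mult. eapply Rle_trans; [apply Rsum_abs |].
  apply Req_le, sum_eq. intros i _. apply Rabs_mult.
Qed.

Lemma entire_mult (c d : nat -> R) : entire c -> entire d -> entire (PS_mult c d).
Proof.
  intros Hc Hd t.
  apply ex_series_dominated with
    (v := PS_mult (fun k => Rabs (c k * t ^ k)) (fun k => Rabs (d k * t ^ k))).
  - intros n. rewrite Rabs_Rabsolu, PS_mult_pow. apply Rabs_PS_mult_le.
  - destruct (Hc t) as [lc Hlc], (Hd t) as [ld Hld].
    exists (lc * ld).
    apply (is_series_mult _ _ _ _ Hlc Hld);
      [eapply ex_series_ext; [| exact (Hc t)] | eapply ex_series_ext; [| exact (Hd t)]];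
      intros n; simpl; now rewrite Rabs_Rabsolu.
Qed.

Lemma theta_PS_mult (c d : nat -> R) (n : nat) :
  theta (PS_mult c d) n = PS_mult (theta c) d n + PS_mult c (theta d) n.
Proof.
  unfold theta, PS_mult. rewrite scal_sum, <- sum_plus. apply sum_eq. intros i Hi.
  rewrite minus_INR by exact Hi. ring.
Qed.

Lemma PS_mult_incr (c d : nat -> R) (n : nat) :
  PS_mult c (PS_incr_1 d) (S n) = PS_mult c d n.
Proof.
  unfold PS_mult. rewrite tech5, Nat.sub_diag.
  change (PS_incr_1 d 0) with 0. rewrite Rmult_0_r, Rplus_0_r.
  apply sum_eq. intros i Hi. now rewrite (Nat.sub_succ_l i n Hi).
Qed.

Lemma PSeries_PS_mult (c d : nat -> R) (t : R) :
  entire c -> entire d -> PSeries (PS_mult c d) t = PSeries c t * PSeries d t.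
Proof. intros Hc Hd. apply PSeries_mult; now apply entire_radius. Qed.

Lemma PSeries_PS_plus (c d : nat -> R) (t : R) :
  entire c -> entire d -> PSeries (PS_plus c d) t = PSeries c t + PSeries d t.
Proof. intros Hc Hd. apply PSeries_plus; now apply entire_ex_pseries. Qed.

(** Evaluation turns convolutions into products of numbers; combined with
    [entire_coef_ext] it lets algebraic identities between series be checked by
    field arithmetic. *)
Lemma PSeries_theta_mult (c d : nat -> R) (t : R) :
  entire c -> entire d ->
  PSeries (theta (PS_mult c d)) t =
  PSeries (theta c) t * PSeries d t + PSeries c t * PSeries (theta d) t.
Proof.
  intros Hc Hd.
  rewrite <- !PSeries_PS_mult, <- PSeries_PS_plus
    by auto using entire_theta, entire_mult.
  apply PSeries_ext, theta_PS_mult.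
Qed.

Lemma entire_coef_ext (c d : nat -> R) (n : nat) :
  entire c -> entire d -> (forall t, PSeries c t = PSeries d t) -> c n = d n.
Proof.
  intros Hc Hd H. apply PSeries_ext_recip; try now apply entire_radius.
  exists (mkposreal 1 Rlt_0_1). intros y _. apply H.
Qed.

(** * Pochhammer symbols and products of two 0F1 series *)

Definition noninteger (b : R) : Prop := forall m : Z, b <> IZR m.

(** Shifts of points near a noninteger stay uniformly away from 0. Every division
    below is controlled by this single constant. *)
Lemma noninteger_gap (b : R) :
  noninteger b ->
  exists eta, 0 < eta /\
    forall s, Rabs (s - b) <= eta -> forall m : Z, eta <= Rabs (s + IZR m).
Proof.
  intros hb.
  destruct (archimed b) as [h1 h2]. set (z := up b) in *.
  assert (h3 : b <> IZR (z - 1)) by apply hb.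
  rewrite minus_IZR in h3.
  exists (Rmin (IZR z - b) (b - (IZR z - 1)) / 2).
  pose proof (Rmin_l (IZR z - b) (b - (IZR z - 1))).
  pose proof (Rmin_r (IZR z - b) (b - (IZR z - 1))).
  assert (0 < Rmin (IZR z - b) (b - (IZR z - 1))) by (apply Rmin_pos; lra).
  set (d := Rmin _ _) in *.
  split; [lra |]. intros s hs m.
  apply Rabs_le_between in hs.
  destruct (Z.le_gt_cases (z + m) 0) as [h | h].
  - apply IZR_le in h. rewrite plus_IZR in h.
    rewrite <- Rabs_Ropp. eapply Rle_trans; [| apply Rle_abs]. lra.
  - assert (h' : (1 <= z + m)%Z) by lia. apply IZR_le in h'. rewrite plus_IZR in h'.
    eapply Rle_trans; [| apply Rle_abs]. lra.
Qed.

Lemma noninteger_shift (b : R) (m : Z) : noninteger b -> noninteger (b + IZR m).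
Proof. intros hb k h. apply (hb (k - m)%Z). rewrite minus_IZR. lra. Qed.

Lemma noninteger_opp (b : R) : noninteger b -> noninteger (- b).
Proof. intros hb k h. apply (hb (- k)%Z). rewrite opp_IZR. lra. Qed.

Lemma noninteger_plus_INR (b : R) (n : nat) : noninteger b -> b + INR n <> 0.
Proof. intros hb h. apply (hb (- Z.of_nat n)%Z). rewrite opp_IZR, <- INR_IZR_INZ. lra. Qed.

Lemma poch_neq_0 (c : R) (n : nat) : (forall k, (k < n)%nat -> c + INR k <> 0) -> poch c n <> 0.
Proof.
  induction n as [|n IH]; simpl; intros h; [lra |].
  apply Rmult_integral_contrapositive_currified; auto.
Qed.

Lemma poch_noninteger (c : R) (n : nat) : noninteger c -> poch c n <> 0.
Proof. intros hc. apply poch_neq_0. intros k _. now apply noninteger_plus_INR. Qed.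

Lemma poch_pos (c : R) (n : nat) : 0 < c -> 0 < poch c n.
Proof.
  intros hc. induction n as [|n IH]; simpl; [lra |].
  apply Rmult_lt_0_compat; [exact IH |]. pose proof (pos_INR n). lra.
Qed.

Lemma poch_add (c : R) (m n : nat) : poch c (m + n) = poch c m * poch (c + INR m) n.
Proof.
  induction n as [|n IH]; [rewrite Nat.add_0_r; simpl; ring |].
  rewrite Nat.add_succ_r. simpl. rewrite IH, plus_INR. ring.
Qed.

Lemma poch_S_l (c : R) (n : nat) : poch c (S n) = c * poch (c + 1) n.
Proof. change (S n) with (1 + n)%nat. rewrite poch_add. simpl. ring. Qed.

Lemma Rabs_inv_poch_le (c eta : R) (n : nat) :
  0 < eta -> (forall k : nat, eta <= Rabs (c + INR k)) ->
  Rabs (/ poch c n) <= (/ eta) ^ n.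
Proof.
  intros heta h. induction n as [|n IH]; simpl.
  - rewrite Rinv_1, Rabs_R1. lra.
  - rewrite Rinv_mult, Rabs_mult, Rmult_comm.
    apply Rmult_le_compat; try apply Rabs_pos; [| exact IH].
    rewrite Rabs_inv. now apply Rinv_le_contravar.
Qed.

Lemma fact_S_R (n : nat) : INR (fact (S n)) = (INR n + 1) * INR (fact n).
Proof. now rewrite fact_simpl, mult_INR, S_INR. Qed.

Lemma INR_S_neq_0 (n : nat) : INR n + 1 <> 0.
Proof. pose proof (pos_INR n). lra. Qed.

(** The generalized binomial coefficient X choose m: the rising factorial of X - m +
    1 is the falling factorial of X. *)
Definition gbinom (X : R) (m : nat) : R := poch (X - INR m + 1) m / INR (fact m).

Lemma gbinom_S (X : R) (m : nat) :
  INR (S m) * gbinom X (S m) = (X - INR m) * gbinom X m.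
Proof.
  unfold gbinom. rewrite poch_S_l, fact_S_R, S_INR.
  replace (X - (INR m + 1) + 1 + 1) with (X - INR m + 1) by ring.
  field. split; [apply INR_fact_neq_0 | apply INR_S_neq_0].
Qed.

(** Both sides satisfy (n + 1) u_(n+1) = (X + Y - n) u_n: on the left, apply the
    product rule for the Euler operator, which by [gbinom_S] gives each term the
    factor (X - i) + (Y - (n - i)). *)
Lemma chu_vandermonde (X Y : R) (n : nat) :
  PS_mult (gbinom X) (gbinom Y) n = gbinom (X + Y) n.
Proof.
  induction n as [|n IH].
  - unfold PS_mult, gbinom. simpl. field.
  - apply Rmult_eq_reg_l with (INR (S n)); [| rewrite S_INR; apply INR_S_neq_0].
    rewrite gbinom_S, <- IH.
    change (theta (PS_mult (gbinom X) (gbinom Y)) (S n) =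
            (X + Y - INR n) * PS_mult (gbinom X) (gbinom Y) n).
    rewrite theta_PS_mult. unfold PS_mult.
    rewrite decomp_sum by lia.
    rewrite (tech5 (fun k => gbinom X k * _)), Nat.sub_diag.
    unfold theta at 1 4. simpl (INR 0). simpl Nat.pred.
    rewrite scal_sum, !Rmult_0_l, Rmult_0_r, Rplus_0_l, Rplus_0_r, <- sum_plus.
    apply sum_eq. intros i Hi.
    unfold theta. rewrite gbinom_S, Nat.sub_succ.
    rewrite (Nat.sub_succ_l i n Hi), gbinom_S, minus_INR by exact Hi. ring.
Qed.

(** Coefficients of 0F1(; c; x). *)
Definition hyp0F1 (c : R) (n : nat) : R := / (INR (fact n) * poch c n).

Lemma hyp0F1_gbinom (c : R) (n i : nat) :
  (forall k, poch c k <> 0) -> (i <= n)%nat ->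
  hyp0F1 c i = gbinom (c + INR n - 1) (n - i) * INR (fact (n - i)) / (INR (fact i) * poch c n).
Proof.
  intros hc hi. unfold hyp0F1, gbinom.
  replace (poch c n) with (poch c i * poch (c + INR i) (n - i))
    by (rewrite <- poch_add; f_equal; lia).
  rewrite minus_INR by exact hi.
  replace (c + INR n - 1 - (INR n - INR i) + 1) with (c + INR i) by ring.
  assert (poch (c + INR i) (n - i) <> 0).
  { intros h. apply (hc (i + (n - i))%nat). rewrite poch_add, h. ring. }
  field. auto using INR_fact_neq_0.
Qed.

(** Over the common denominator (c)_n (d)_n the summands are products of binomial
    coefficients with upper entries c + n - 1 and d + n - 1, so that Chu-Vandermonde
    applies. *)
Lemma hyp0F1_mult (c d : R) (n : nat) :
  (forall k, poch c k <> 0) -> (forall k, poch d k <> 0) ->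
  PS_mult (hyp0F1 c) (hyp0F1 d) n =
  poch (c + d + INR n - 1) n / (INR (fact n) * poch c n * poch d n).
Proof.
  intros hc hd.
  replace (poch (c + d + INR n - 1) n / (INR (fact n) * poch c n * poch d n))
    with (/ (poch c n * poch d n) * gbinom ((d + INR n - 1) + (c + INR n - 1)) n).
  2:{ unfold gbinom.
      replace (d + INR n - 1 + (c + INR n - 1) - INR n + 1) with (c + d + INR n - 1) by ring.
      field. auto using INR_fact_neq_0. }
  rewrite <- chu_vandermonde. unfold PS_mult. rewrite scal_sum.
  apply sum_eq. intros i hi.
  rewrite (hyp0F1_gbinom c n i hc hi), (hyp0F1_gbinom d n (n - i) hd) by lia.
  replace (n - (n - i))%nat with i by lia.
  field. auto using INR_fact_neq_0.
Qed.

Lemma hyp0F1_dominated (c eta : R) (n : nat) :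
  0 < eta -> (forall k : nat, eta <= Rabs (c + INR k)) ->
  Rabs (hyp0F1 c n) <= (/ eta) ^ n / INR (fact n).
Proof.
  intros heta h. unfold hyp0F1. rewrite Rinv_mult, Rabs_mult, Rmult_comm.
  rewrite (Rabs_pos_eq (/ INR (fact n))) by (left; apply Rinv_0_lt_compat, INR_fact_lt_0).
  apply Rmult_le_compat_r; [left; apply Rinv_0_lt_compat, INR_fact_lt_0 |].
  now apply Rabs_inv_poch_le.
Qed.

Lemma noninteger_gap_INR (b : R) :
  noninteger b -> exists eta, 0 < eta /\ forall k : nat, eta <= Rabs (b + INR k).
Proof.
  intros hb. destruct (noninteger_gap b hb) as [eta [heta h]].
  exists eta. split; [exact heta |]. intros k. rewrite INR_IZR_INZ. apply h.
  rewrite Rminus_diag, Rabs_R0. lra.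
Qed.

Lemma entire_hyp0F1 (c : R) : noninteger c -> entire (hyp0F1 c).
Proof.
  intros hc. destruct (noninteger_gap_INR c hc) as [eta [heta h]].
  apply entire_dominated with (K := 1) (2 := entire_exp (/ eta)).
  intros n. rewrite Rmult_1_l.
  eapply Rle_trans; [| apply Rle_abs]. now apply hyp0F1_dominated.
Qed.

(** x times the operator x u'' + c u' in terms of the Euler operator. *)
Definition bessel_op (c : R) (u : nat -> R) : nat -> R :=
  PS_plus (theta (theta u)) (PS_scal (c - 1) (theta u)).

Lemma bessel_op_S (c : R) (u : nat -> R) (n : nat) :
  bessel_op c u (S n) = (INR n + 1) * (c + INR n) * u (S n).
Proof.
  unfold bessel_op, PS_plus, PS_scal, theta, plus, scal; simpl. unfold mult; simpl.
  change (match n with O => 1 | S _ => INR n + 1 end) with (INR (S n)). rewrite S_INR. ring.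
Qed.

Lemma hyp0F1_ode (c : R) (n : nat) :
  (forall k, poch c k <> 0) -> bessel_op c (hyp0F1 c) n = PS_incr_1 (hyp0F1 c) n.
Proof.
  intros hc. destruct n as [|n].
  - unfold bessel_op, PS_plus, PS_scal, theta, plus, scal, zero; simpl.
    unfold mult, zero; simpl. ring.
  - rewrite bessel_op_S. simpl PS_incr_1. unfold hyp0F1. rewrite fact_S_R.
    pose proof (hc (S n)) as h. simpl poch in h |- *.
    field. repeat split; auto using INR_fact_neq_0, INR_S_neq_0.
    intros h'. apply h. rewrite h'. ring.
Qed.

Lemma theta_hyp0F1 (c : R) (n : nat) :
  (forall k, poch c k <> 0) ->
  theta (hyp0F1 c) n = PS_incr_1 (PS_scal (/ c) (hyp0F1 (c + 1))) n.
Proof.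
  intros hc. destruct n as [|n].
  - unfold theta, zero; simpl. unfold zero; simpl. ring.
  - unfold theta, hyp0F1, PS_incr_1, PS_scal, scal; simpl PS_incr_1. simpl. unfold mult; simpl.
    change (match n with O => 1 | S _ => INR n + 1 end) with (INR (S n)).
    change (fact n + n * fact n)%nat with (fact (S n)).
    rewrite fact_S_R, S_INR.
    pose proof (poch_S_l c n) as e. pose proof (hc (S n)) as h. simpl in e, h.
    rewrite e in h |- *.
    field. repeat split; auto using INR_fact_neq_0, INR_S_neq_0.
    + intros h'. apply h. rewrite h'. ring.
    + intros h'. apply h. rewrite h'. ring.
Qed.

(** * Variation of parameters for the harmonic series *)

Lemma theta_ext (c d : nat -> R) : (forall n, c n = d n) -> forall n, theta c n = theta d n.
Proof. intros h n. unfold theta. now rewrite h. Qed.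

Lemma PSeries_theta_plus (c d : nat -> R) (t : R) :
  entire c -> entire d ->
  PSeries (theta (PS_plus c d)) t = PSeries (theta c) t + PSeries (theta d) t.
Proof.
  intros hc hd. rewrite <- PSeries_PS_plus by auto using entire_theta.
  apply PSeries_ext. intros n. unfold theta, PS_plus, plus; simpl. ring.
Qed.

Lemma PSeries_theta_scal (k : R) (c : nat -> R) (t : R) :
  PSeries (theta (PS_scal k c)) t = k * PSeries (theta c) t.
Proof.
  rewrite <- PSeries_scal. apply PSeries_ext. intros n.
  unfold theta, PS_scal, scal; simpl. unfold mult; simpl. ring.
Qed.

Lemma PSeries_theta2_mult (c d : nat -> R) (t : R) :
  entire c -> entire d ->
  PSeries (theta (theta (PS_mult c d))) t =
  PSeries (theta (theta c)) t * PSeries d t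
  + 2 * (PSeries (theta c) t * PSeries (theta d) t)
  + PSeries c t * PSeries (theta (theta d)) t.
Proof.
  intros hc hd.
  rewrite (PSeries_ext _ (theta (PS_plus (PS_mult (theta c) d) (PS_mult c (theta d)))))
    by (apply theta_ext; intros n; apply theta_PS_mult).
  rewrite PSeries_theta_plus, !PSeries_theta_mult by auto using entire_theta, entire_mult.
  ring.
Qed.

Lemma PSeries_bessel_op (c : R) (u : nat -> R) (t : R) :
  entire u ->
  PSeries (bessel_op c u) t = PSeries (theta (theta u)) t + (c - 1) * PSeries (theta u) t.
Proof.
  intros hu. unfold bessel_op.
  rewrite PSeries_PS_plus by auto using entire_theta, entire_scal.
  now rewrite PSeries_scal.
Qed.

(** A function killed by x d/dx is constant. *)
Lemma PSeries_theta_eq_0 (c : nat -> R) :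
  entire c -> (forall t, PSeries (theta c) t = 0) -> forall t, PSeries c t = c O.
Proof.
  intros hc h t.
  assert (e : forall n, c (S n) = 0).
  { intros n. apply Rmult_eq_reg_l with (INR (S n)); [| now apply not_0_INR].
    rewrite Rmult_0_r. apply (entire_coef_ext (theta c) (fun _ => 0)).
    - now apply entire_theta.
    - apply entire_dominated with (K := 0) (2 := hc). intros k. rewrite Rabs_R0. lra.
    - intros s. now rewrite h, PSeries_const_0. }
  unfold PSeries. rewrite Series_incr_1 by now apply entire_ex_series.
  rewrite (Series_ext _ (fun n => 0 * t ^ n)) by (intros n; rewrite e; ring).
  fold (PSeries (fun _ => 0) t). rewrite PSeries_const_0. simpl. ring.
Qed.

(** The increment of the digamma function from b to b + n, and minus the logarithmic
    derivative of 1 / (b)_n in b. *)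
Fixpoint harmonic (b : R) (n : nat) : R :=
  match n with
  | O => 0
  | S j => harmonic b j + / (b + INR j)
  end.

(** Coefficient function of the first homogeneous solution, obtained by integrating
    (b - 1) P' = 0F1(; 2 - b) (0F1(; b))' termwise. At n = 0 numerator and
    denominator vanish and the quotient is 0, the wanted constant of integration. *)
Definition coefP (b : R) (n : nat) : R :=
  PS_mult (hyp0F1 (2 - b)) (theta (hyp0F1 b)) n / ((b - 1) * INR n).

(** Coefficient function of the second homogeneous solution, solving (1 - b) (x Q' +
    (b - 1) Q) = x 0F1(; b) (0F1(; b))' termwise. *)
Definition coefQ (b : R) (n : nat) : R :=
  PS_mult (hyp0F1 b) (theta (hyp0F1 b)) n / ((1 - b) * (b - 1 + INR n)).

Lemma noninteger_2_minus (b : R) : noninteger b -> noninteger (2 - b).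
Proof.
  intros hb. replace (2 - b) with (- b + IZR 2) by (simpl; ring).
  now apply noninteger_shift, noninteger_opp.
Qed.

Lemma noninteger_neq (b : R) (m : Z) : noninteger b -> b - IZR m <> 0.
Proof. intros hb h. apply (hb m). lra. Qed.

Lemma PS_mult_theta_0 (c d : nat -> R) : PS_mult c (theta d) 0 = 0.
Proof. unfold PS_mult, theta. simpl. ring. Qed.

Lemma entire_coefP (b : R) : noninteger b -> entire (coefP b).
Proof.
  intros hb.
  apply entire_dominated with (K := Rabs (/ (b - 1)))
    (d := PS_mult (hyp0F1 (2 - b)) (theta (hyp0F1 b))).
  - intros n. unfold coefP, Rdiv. rewrite Rinv_mult, !Rabs_mult.
    pose proof (Rabs_pos (/ (b - 1))) as h1.
    pose proof (Rabs_pos (PS_mult (hyp0F1 (2 - b)) (theta (hyp0F1 b)) n)) as h2.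
    assert (h3 : Rabs (/ INR n) <= 1).
    { destruct n as [|n]; [simpl; rewrite Rinv_0, Rabs_R0; lra |].
      rewrite Rabs_inv, Rabs_pos_eq, <- Rinv_1 by apply pos_INR.
      apply Rinv_le_contravar; [lra |]. rewrite S_INR. pose proof (pos_INR n). lra. }
    rewrite Rmult_comm. apply Rmult_le_compat_r; [exact h2 |].
    rewrite <- (Rmult_1_r (Rabs (/ (b - 1)))) at 2. now apply Rmult_le_compat_l.
  - apply entire_mult; [| apply entire_theta];
      apply entire_hyp0F1; auto using noninteger_2_minus.
Qed.

Lemma entire_coefQ (b : R) : noninteger b -> entire (coefQ b).
Proof.
  intros hb.
  destruct (noninteger_gap_INR (b - 1)) as [eta [heta h]].
  { apply (noninteger_shift b (-1)). exact hb. }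
  apply entire_dominated with (K := Rabs (/ (1 - b)) * / eta)
    (d := PS_mult (hyp0F1 b) (theta (hyp0F1 b))).
  - intros n. unfold coefQ, Rdiv. rewrite Rinv_mult, !Rabs_mult, Rmult_comm.
    apply Rmult_le_compat_r; [apply Rabs_pos |].
    apply Rmult_le_compat_l; [apply Rabs_pos |].
    rewrite Rabs_inv. now apply Rinv_le_contravar.
  - apply entire_mult; [| apply entire_theta]; now apply entire_hyp0F1.
Qed.

Lemma entire_harmonic (b : R) :
  noninteger b -> entire (fun n => harmonic b n * hyp0F1 b n).
Proof.
  intros hb. destruct (noninteger_gap_INR b hb) as [eta [heta h]].
  apply entire_dominated with (K := / eta) (d := theta (hyp0F1 b)).
  - intros n. unfold theta. rewrite !Rabs_mult, <- Rmult_assoc.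
    apply Rmult_le_compat_r; [apply Rabs_pos |].
    rewrite (Rabs_pos_eq (INR n)) by apply pos_INR.
    induction n as [|n IH]; [simpl; rewrite Rabs_R0; lra |].
    rewrite S_INR. simpl harmonic. eapply Rle_trans; [apply Rabs_triang |].
    assert (Rabs (/ (b + INR n)) <= / eta)
      by (rewrite Rabs_inv; now apply Rinv_le_contravar).
    lra.
  - now apply entire_theta, entire_hyp0F1.
Qed.

Lemma PSeries_theta2_hyp0F1 (c t : R) :
  noninteger c ->
  PSeries (theta (theta (hyp0F1 c))) t =
  t * PSeries (hyp0F1 c) t - (c - 1) * PSeries (theta (hyp0F1 c)) t.
Proof.
  intros hc.
  assert (e := PSeries_ext _ _ t (fun n => hyp0F1_ode c n (fun k => poch_noninteger c k hc))).
  rewrite PSeries_bessel_op, PSeries_incr_1 in e by now apply entire_hyp0F1.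
  lra.
Qed.

(** The left side is x^b times the Wronskian of 0F1(; b; x) and x^(1 - b) 0F1(; 2 -
    b; x). Its image under x d/dx vanishes by the two differential equations, and
    its value at 0 is 1 - b. *)
Lemma wronskian (b t : R) :
  noninteger b ->
  PSeries (hyp0F1 b) t * PSeries (theta (hyp0F1 (2 - b))) t
  - PSeries (theta (hyp0F1 b)) t * PSeries (hyp0F1 (2 - b)) t
  + (1 - b) * (PSeries (hyp0F1 b) t * PSeries (hyp0F1 (2 - b)) t) = 1 - b.
Proof.
  intros hb. pose proof (noninteger_2_minus b hb) as hb2.
  pose proof (entire_hyp0F1 b hb) as ha. pose proof (entire_hyp0F1 _ hb2) as ha2.
  set (u := hyp0F1 b) in *. set (v := hyp0F1 (2 - b)) in *.
  set (w := PS_plus (PS_plus (PS_mult u (theta v)) (PS_scal (-1) (PS_mult (theta u) v)))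
                    (PS_scal (1 - b) (PS_mult u v))).
  assert (hw : entire w)
    by (unfold w; auto 8 using entire_plus, entire_scal, entire_mult, entire_theta).
  assert (ew : forall s, PSeries w s = PSeries u s * PSeries (theta v) s
     - PSeries (theta u) s * PSeries v s + (1 - b) * (PSeries u s * PSeries v s)).
  { intros s. unfold w.
    rewrite !PSeries_PS_plus, !PSeries_scal, !PSeries_PS_mult
      by auto 8 using entire_plus, entire_scal, entire_mult, entire_theta.
    ring. }
  rewrite <- ew, PSeries_theta_eq_0; [| exact hw |].
  - unfold w, PS_plus, PS_scal, PS_mult, plus, scal, u, v, hyp0F1, theta; simpl.
    unfold mult; simpl. field.
  - intros s. unfold w.
    rewrite !PSeries_theta_plus, !PSeries_theta_scal, !PSeries_theta_mult
      by auto 8 using entire_plus, entire_scal, entire_mult, entire_theta.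
    unfold u, v. rewrite !PSeries_theta2_hyp0F1 by assumption.
    ring.
Qed.

Lemma theta_coefP (b t : R) :
  noninteger b ->
  PSeries (theta (coefP b)) t =
  PSeries (hyp0F1 (2 - b)) t * PSeries (theta (hyp0F1 b)) t / (b - 1) /\
  PSeries (theta (theta (coefP b))) t =
  (PSeries (theta (hyp0F1 (2 - b))) t * PSeries (theta (hyp0F1 b)) t
   + PSeries (hyp0F1 (2 - b)) t * PSeries (theta (theta (hyp0F1 b))) t) / (b - 1).
Proof.
  intros hb.
  pose proof (entire_hyp0F1 b hb). pose proof (entire_hyp0F1 _ (noninteger_2_minus b hb)).
  assert (e : forall n, theta (coefP b) n =
     PS_scal (/ (b - 1)) (PS_mult (hyp0F1 (2 - b)) (theta (hyp0F1 b))) n).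
  { intros n. unfold PS_scal, scal, coefP; simpl; unfold mult; simpl. unfold theta at 1.
    destruct n as [|n]; [rewrite PS_mult_theta_0; simpl; ring |].
    field. split; [apply (noninteger_neq b 1 hb) | now apply not_0_INR]. }
  split.
  - rewrite (PSeries_ext _ _ t e), PSeries_scal, PSeries_PS_mult by auto using entire_theta.
    unfold Rdiv. ring.
  - rewrite (PSeries_ext _ _ t (theta_ext _ _ e)), PSeries_theta_scal, PSeries_theta_mult
      by auto using entire_theta.
    unfold Rdiv. ring.
Qed.

Lemma theta_coefQ (b t : R) :
  noninteger b ->
  PSeries (theta (coefQ b)) t =
  PSeries (hyp0F1 b) t * PSeries (theta (hyp0F1 b)) t / (1 - b)
  - (b - 1) * PSeries (coefQ b) t /\
  PSeries (theta (theta (coefQ b))) t =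
  (PSeries (theta (hyp0F1 b)) t * PSeries (theta (hyp0F1 b)) t
   + PSeries (hyp0F1 b) t * PSeries (theta (theta (hyp0F1 b))) t) / (1 - b)
  - (b - 1) * PSeries (theta (coefQ b)) t.
Proof.
  intros hb.
  pose proof (entire_hyp0F1 b hb). pose proof (entire_coefQ b hb).
  assert (e : forall n, theta (coefQ b) n =
     PS_plus (PS_scal (/ (1 - b)) (PS_mult (hyp0F1 b) (theta (hyp0F1 b))))
             (PS_scal (- (b - 1)) (coefQ b)) n).
  { intros n. unfold PS_plus, PS_scal, scal, plus, coefQ; simpl; unfold mult; simpl.
    unfold theta at 1.
    pose proof (noninteger_neq b 1 hb).
    pose proof (noninteger_plus_INR (b - 1) n (noninteger_shift b (-1) hb)).
    field. split; lra. }
  split.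
  - rewrite (PSeries_ext _ _ t e), PSeries_PS_plus, !PSeries_scal, PSeries_PS_mult
      by auto using entire_theta, entire_scal, entire_mult.
    unfold Rdiv. ring.
  - rewrite (PSeries_ext _ _ t (theta_ext _ _ e)), PSeries_theta_plus, !PSeries_theta_scal,
      PSeries_theta_mult
      by auto using entire_theta, entire_scal, entire_mult.
    unfold Rdiv. ring.
Qed.

(** Both sides vanish at n = 0 and satisfy the recurrence (n + 1) (b + n) u_(n+1) =
    u_n + (n + 1) a_(n+1), where a is [hyp0F1 b]. For the right side the recurrence
    is the coefficient form of the inhomogeneous equation, which holds for the sums
    by the equations for P and Q and the Wronskian. *)
Lemma harmonic_variation_of_parameters (b : R) (n : nat) :
  noninteger b ->
  harmonic b n * hyp0F1 b n =
  PS_plus (PS_mult (hyp0F1 b) (coefP b)) (PS_mult (hyp0F1 (2 - b)) (coefQ b)) n.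
Proof.
  intros hb. pose proof (noninteger_2_minus b hb) as hb2.
  pose proof (entire_hyp0F1 b hb) as ha. pose proof (entire_hyp0F1 _ hb2) as ha2.
  pose proof (entire_coefP b hb) as hP. pose proof (entire_coefQ b hb) as hQ.
  set (s := PS_plus (PS_mult (hyp0F1 b) (coefP b)) (PS_mult (hyp0F1 (2 - b)) (coefQ b))).
  assert (hs : entire s) by (unfold s; auto using entire_plus, entire_mult).
  assert (ode : forall k, bessel_op b s k = PS_plus (PS_incr_1 s) (theta (hyp0F1 b)) k).
  { intros k. apply entire_coef_ext.
    - unfold bessel_op. auto using entire_plus, entire_scal, entire_theta.
    - auto using entire_plus, entire_incr, entire_theta.
    - intros t. rewrite PSeries_bessel_op, PSeries_PS_plus, PSeries_incr_1
        by auto using entire_incr, entire_theta.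
      unfold s.
      rewrite (PSeries_ext (theta (theta _))
        (theta (PS_plus (theta (PS_mult (hyp0F1 b) (coefP b)))
                        (theta (PS_mult (hyp0F1 (2 - b)) (coefQ b)))))).
      2:{ apply theta_ext. intros j. unfold theta, PS_plus, plus; simpl. ring. }
      rewrite !PSeries_theta_plus, !PSeries_theta2_mult, !PSeries_theta_mult,
        !PSeries_PS_plus, !PSeries_PS_mult by auto using entire_theta, entire_mult.
      destruct (theta_coefP b t hb) as [P1 P2]. destruct (theta_coefQ b t hb) as [Q1 Q2].
      pose proof (wronskian b t hb) as W.
      rewrite P1, P2, Q2, Q1, !PSeries_theta2_hyp0F1 by assumption. clear P1 P2 Q1 Q2.
      set (A := PSeries (hyp0F1 b) t) in *. set (A1 := PSeries (theta (hyp0F1 b)) t) in *.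
      set (B := PSeries (hyp0F1 (2 - b)) t) in *.
      set (B1 := PSeries (theta (hyp0F1 (2 - b))) t) in *.
      set (P := PSeries (coefP b) t). set (Q := PSeries (coefQ b) t).
      assert (hd : b - 1 <> 0) by apply (noninteger_neq b 1 hb).
      (* The difference of the two sides is a multiple of the Wronskian identity. *)
      apply Rminus_diag_uniq.
      transitivity (A1 / (1 - b) * (A * B1 - A1 * B + (1 - b) * (A * B) - (1 - b)));
        [field; lra | rewrite W; field; lra]. }
  induction n as [|n IH].
  - unfold s, PS_plus, PS_mult, coefP, coefQ, plus; simpl.
    rewrite !PS_mult_theta_0. unfold Rdiv. ring.
  - specialize (ode (S n)). rewrite bessel_op_S in ode.
    unfold PS_plus at 1, plus in ode; simpl in ode. rewrite <- IH in ode.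
    pose proof (noninteger_plus_INR b n hb) as h1. pose proof (INR_S_neq_0 n) as h2.
    apply Rmult_eq_reg_l with ((INR n + 1) * (b + INR n));
      [| now apply Rmult_integral_contrapositive_currified].
    rewrite ode. unfold theta.
    pose proof (hyp0F1_ode b (S n) (fun k => poch_noninteger b k hb)) as e.
    rewrite bessel_op_S in e. simpl in e. rewrite <- e, S_INR. simpl harmonic.
    field. exact h1.
Qed.

(** * Dominated limits of series *)

Lemma ex_series_dominated_from (u v : nat -> R) (N : nat) :
  (forall n, (N <= n)%nat -> Rabs (u n) <= v n) -> ex_series v -> ex_series u.
Proof.
  intros h hv. apply (ex_series_incr_n u N). apply (ex_series_incr_n v N) in hv.
  apply ex_series_dominated with (2 := hv). intros n. apply h. lia.
Qed.

Lemma Series_tail_small (M : nat -> R) (N : nat) (eps : posreal) :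
  ex_series M ->
  exists n, (N <= n)%nat /\ Rabs (Series (fun k => M (S n + k)%nat)) < eps.
Proof.
  intros hM. pose proof (Series_correct M hM) as h.
  apply is_series_Reals in h. destruct (h eps (cond_pos eps)) as [n0 hn].
  exists (max N n0). split; [lia |].
  specialize (hn (max N n0) ltac:(lia)). unfold R_dist, Rdist in hn.
  rewrite (Series_incr_n M (S (max N n0))) in hn by (lia || exact hM).
  simpl Nat.pred in hn.
  rewrite <- Rabs_Ropp.
  replace (- Series (fun k => M (S (max N n0) + k)%nat))
    with (sum_f_R0 M (max N n0) -
      (sum_f_R0 M (max N n0) + Series (fun k => M (S (max N n0) + k)%nat))) by ring.
  exact hn.
Qed.

Lemma filterlim_sum_f_R0 {T} (F : (T -> Prop) -> Prop) {FF : Filter F}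
    (g : nat -> T -> R) (l : nat -> R) (n : nat) :
  (forall k, filterlim (g k) F (locally (l k))) ->
  filterlim (fun y => sum_f_R0 (fun k => g k y) n) F (locally (sum_f_R0 l n)).
Proof.
  intros h. induction n as [|n IH]; simpl; [apply h |].
  eapply filterlim_comp_2; [exact IH | apply h |].
  exact (@filterlim_plus R_AbsRing R_NormedModule _ _).
Qed.

Lemma Rabs_Series_le (u v : nat -> R) :
  (forall n, Rabs (u n) <= v n) -> ex_series v -> Rabs (Series u) <= Series v.
Proof.
  intros h hv. eapply Rle_trans.
  - apply Series_Rabs. apply ex_series_dominated with (2 := hv).
    intros n. now rewrite Rabs_Rabsolu.
  - apply Series_le; [| exact hv]. intros n. split; [apply Rabs_pos | apply h].
Qed.

(** Dominated convergence for series along an arbitrary filter. The bound is only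
    asked of the terms from N on, since finitely many terms converge anyway. *)
Lemma tannery {T} (F : (T -> Prop) -> Prop) {FF : ProperFilter F}
    (g : nat -> T -> R) (l M : nat -> R) (N : nat) :
  ex_series M ->
  (forall k, filterlim (g k) F (locally (l k))) ->
  F (fun y => forall k, (N <= k)%nat -> Rabs (g k y) <= M k) ->
  filterlim (fun y => Series (fun k => g k y)) F (locally (Series l)).
Proof.
  intros hM hg hb.
  assert (hl : forall k, (N <= k)%nat -> Rabs (l k) <= M k).
  { intros k hk. apply Rnot_lt_le. intros hlt.
    assert (he : 0 < Rabs (l k) - M k) by lra.
    pose proof (proj1 (filterlim_locally (g k) (l k)) (hg k) (mkposreal _ he)) as h.
    destruct (filter_ex _ (filter_and _ _ h hb)) as [y [h1 h2]].
    specialize (h2 k hk). change (Rabs (g k y - l k) < Rabs (l k) - M k) in h1.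
    pose proof (Rabs_triang_inv (l k) (g k y)) as h3. rewrite Rabs_minus_sym in h3. lra. }
  apply filterlim_locally. intros eps.
  assert (he : 0 < eps / 3) by (pose proof (cond_pos eps); lra).
  destruct (Series_tail_small M N (mkposreal _ he) hM) as [n [hn ht]].
  change (pos (mkposreal _ he)) with (eps / 3) in ht.
  pose proof (filterlim_sum_f_R0 F g l n hg) as hsum.
  pose proof (proj1 (filterlim_locally _ _) hsum (mkposreal _ he)) as hs.
  generalize (filter_and _ _ hs hb). apply filter_imp. intros y [h1 h2].
  change (Rabs (sum_f_R0 (fun k => g k y) n - sum_f_R0 l n) < eps / 3) in h1.
  change (Rabs (Series (fun k => g k y) - Series l) < eps).
  assert (hMn : ex_series (fun k => M (S n + k)%nat)) by now apply (ex_series_incr_n M (S n)).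
  rewrite (Series_incr_n _ (S n)) by
    (lia || apply ex_series_dominated_from with (1 := h2) (2 := hM)).
  rewrite (Series_incr_n l (S n)) by
    (lia || apply ex_series_dominated_from with (1 := hl) (2 := hM)).
  simpl Nat.pred.
  assert (b1 : Rabs (Series (fun k => g (S n + k)%nat y)) <= Series (fun k => M (S n + k)%nat))
    by (apply Rabs_Series_le; [intros k; apply h2; lia | exact hMn]).
  assert (b2 : Rabs (Series (fun k => l (S n + k)%nat)) <= Series (fun k => M (S n + k)%nat))
    by (apply Rabs_Series_le; [intros k; apply hl; lia | exact hMn]).
  pose proof (Rle_abs (Series (fun k => M (S n + k)%nat))).
  apply Rabs_lt_between in h1. apply Rabs_le_between in b1. apply Rabs_le_between in b2.
  apply Rabs_lt_between. lra.
Qed.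

Lemma is_derive_filterlim (f : R -> R) (x d : R) :
  is_derive f x d <->
  filterlim (fun y => (f y - f x) / (y - x)) (locally' x) (locally d).
Proof.
  rewrite is_derive_Reals. split.
  - intros h. apply filterlim_locally. intros eps.
    destruct (h eps (cond_pos eps)) as [delta hd]. exists delta. intros y hy hne.
    change (Rabs (y - x) < delta) in hy. change (Rabs ((f y - f x) / (y - x) - d) < eps).
    specialize (hd (y - x) (Rminus_eq_contra y x hne) hy). now rewrite Rplus_minus in hd.
  - intros h eps heps.
    destruct (proj1 (filterlim_locally _ _) h (mkposreal eps heps)) as [delta hd].
    exists delta. intros k hk hlt.
    assert (hb : ball x delta (x + k)).
    { change (Rabs (x + k - x) < delta). now replace (x + k - x) with k by ring. }
    specialize (hd (x + k) hb ltac:(lra)).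
    change (Rabs ((f (x + k) - f x) / (x + k - x) - d) < eps) in hd.
    now replace (x + k - x) with k in hd by ring.
Qed.

(** Dominated convergence of the difference quotients. A Lipschitz bound at x
    suffices, and only for the terms from N on; the first terms only need a
    derivative at x. *)
Lemma is_derive_Series (f : nat -> R -> R) (x : R) (d M : nat -> R) (N : nat) :
  ex_series M ->
  ex_series (fun k => f k x) ->
  (forall k, is_derive (f k) x (d k)) ->
  locally x (fun y => forall k, (N <= k)%nat ->
    Rabs (f k y - f k x) <= M k * Rabs (y - x)) ->
  is_derive (fun y => Series (fun k => f k y)) x (Series d).
Proof.
  intros hM hx hd hb. apply is_derive_filterlim.
  assert (hq : locally' x (fun y => y <> x /\ forall k, (N <= k)%nat ->
    Rabs ((f k y - f k x) / (y - x)) <= M k)).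
  { destruct hb as [delta hb]. exists delta. intros y hy hne. split; [exact hne |].
    intros k hk. specialize (hb y hy k hk).
    pose proof (Rminus_eq_contra y x hne) as hne'.
    pose proof (Rabs_pos_lt _ hne').
    rewrite Rabs_div by exact hne'. apply Rle_div_l; assumption. }
  apply filterlim_ext_loc with (fun y => Series (fun k => (f k y - f k x) / (y - x))).
  - revert hq. apply filter_imp. intros y [hne hy].
    assert (hs : ex_series (fun k => (f k y - f k x) / (y - x)))
      by (apply ex_series_dominated_from with (1 := hy) (2 := hM)).
    assert (hs' : ex_series (fun k => f k y - f k x)).
    { apply ex_series_ext with (fun k => (y - x) * ((f k y - f k x) / (y - x))).
      - intros k. simpl. field. lra.
      - now apply (ex_series_scal_l (y - x) (fun k => (f k y - f k x) / (y - x))). }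
    assert (hy' : ex_series (fun k => f k y)).
    { apply ex_series_ext with (fun k => (f k y - f k x) + f k x).
      - intros k. simpl. ring.
      - now apply (ex_series_plus (fun k => f k y - f k x) (fun k => f k x)). }
    rewrite <- Series_minus by assumption. unfold Rdiv. now rewrite Series_scal_r.
  - apply (@tannery R (locally' x) (Rbar_locally'_filter x)) with (M := M) (N := N);
      [exact hM | |].
    + intros k. apply is_derive_filterlim, hd.
    + revert hq. apply filter_imp. now intros y [_ hy].
Qed.

(** * Closed forms of the two coefficient functions *)

Lemma poch_duplication (c : R) (n : nat) :
  poch c n * poch (c + 1 / 2) n * 4 ^ n = poch (2 * c) n * poch (2 * c + INR n) n.
Proof.
  rewrite <- poch_add.
  induction n as [|n IH]; [simpl; ring |].
  replace (S n + S n)%nat with (S (S (n + n))) by lia.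
  cbn [poch pow]. rewrite <- IH, S_INR, plus_INR. field.
Qed.

Lemma poch_1_fact (n : nat) : poch 1 n = INR (fact n).
Proof.
  induction n as [|n IH]; [reflexivity |]. simpl poch. rewrite IH, fact_S_R. ring.
Qed.

Lemma poch_2_fact (n : nat) : poch 2 n = INR (fact (S n)).
Proof.
  rewrite <- poch_1_fact, poch_S_l, Rmult_1_l. reflexivity.
Qed.

Lemma PS_mult_theta_hyp0F1 (c : nat -> R) (b : R) (m : nat) :
  noninteger b ->
  PS_mult c (theta (hyp0F1 b)) (S m) = / b * PS_mult c (hyp0F1 (b + 1)) m.
Proof.
  intros hb.
  transitivity (PS_mult c (PS_incr_1 (PS_scal (/ b) (hyp0F1 (b + 1)))) (S m)).
  - unfold PS_mult. apply sum_eq. intros i _. f_equal. apply theta_hyp0F1.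
    intros k. now apply poch_noninteger.
  - rewrite PS_mult_incr. unfold PS_mult. rewrite scal_sum. apply sum_eq. intros i _.
    unfold PS_scal, scal; simpl; unfold mult; simpl. ring.
Qed.

Lemma coefP_S (b : R) (m : nat) :
  noninteger b ->
  coefP b (S m) =
  poch (2 + INR m) m /
  (b * (b - 1) * (INR m + 1) * INR (fact m) * poch (2 - b) m * poch (1 + b) m).
Proof.
  intros hb. unfold coefP.
  assert (h : forall k, poch (2 - b) k <> 0)
    by (intros k; now apply poch_noninteger, noninteger_2_minus).
  assert (h1 : forall k, poch (b + 1) k <> 0)
    by (intros k; now apply poch_noninteger, (noninteger_shift b 1)).
  assert (h0 : b <> 0) by (intros e; now apply (hb 0%Z)).
  rewrite PS_mult_theta_hyp0F1, hyp0F1_mult, S_INR by assumption.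
  replace (2 - b + (b + 1) + INR m - 1) with (2 + INR m) by ring.
  rewrite (Rplus_comm 1 b). field.
  repeat split; auto using INR_fact_neq_0, INR_S_neq_0.
  apply (noninteger_neq b 1 hb).
Qed.

(** Coefficients of 2F3(b, 1/2 + b; 2b, 1 + b, 1 + b; 4x) in powers of x, after the
    cancellation 4^m (b)_m (1/2 + b)_m / (2b)_m = (2b + m)_m. This form stays
    meaningful when 2b is a nonpositive integer. *)
Definition coef2F3 (b : R) (m : nat) : R :=
  poch (2 * b + INR m) m / (INR (fact m) * poch (1 + b) m ^ 2).

(** Writing the coefficient as a convolution bounds it locally uniformly in b: each
    0F1 factor is dominated by an exponential series. *)
Lemma coef2F3_hyp0F1 (b : R) (m : nat) :
  noninteger b ->
  coef2F3 b m = b / (b + INR m) * PS_mult (hyp0F1 b) (hyp0F1 (b + 1)) m.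
Proof.
  intros hb.
  assert (h : forall k, poch b k <> 0) by (intros k; now apply poch_noninteger).
  assert (h1 : forall k, poch (b + 1) k <> 0)
    by (intros k; now apply poch_noninteger, (noninteger_shift b 1)).
  rewrite hyp0F1_mult by assumption. unfold coef2F3.
  replace (b + (b + 1) + INR m - 1) with (2 * b + INR m) by ring.
  rewrite (Rplus_comm 1 b).
  pose proof (noninteger_plus_INR b m hb) as hm.
  assert (e : poch (b + 1) m = poch b m * (b + INR m) / b).
  { pose proof (poch_S_l b m) as e. simpl in e. rewrite e. field.
    intros e'. now apply (hb 0%Z). }
  rewrite e. field. repeat split; auto using INR_fact_neq_0; intros e'; now apply (hb 0%Z).
Qed.

Lemma coefQ_S (b : R) (m : nat) :
  noninteger b -> coefQ b (S m) = coef2F3 b m / (b ^ 2 * (1 - b)).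
Proof.
  intros hb. rewrite (coef2F3_hyp0F1 b m hb). unfold coefQ.
  assert (h0 : b <> 0) by (intros e; now apply (hb 0%Z)).
  rewrite PS_mult_theta_hyp0F1, S_INR by exact hb. pose proof (noninteger_plus_INR b m hb) as hm.
  pose proof (noninteger_neq b 1 hb).
  field. repeat split; try lra.
Qed.

(** With the duplication formula at c = 1, (m + 2)_m = 4^m (3/2)_m / (m + 1), while
    (1)_m / (2)_m = 1 / (m + 1). *)
Lemma PSeries_coefP (b x : R) :
  noninteger b ->
  PSeries (coefP b) x =
  x / (b * (b - 1)) * pFq [1; 1; 3 / 2] [2; 2; 1 + b; 2 - b] (4 * x).
Proof.
  intros hb. pose proof (entire_coefP b hb) as hP.
  assert (h0 : b <> 0) by (intros e; now apply (hb 0%Z)).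
  pose proof (noninteger_neq b 1 hb) as h1.
  rewrite PSeries_decr_1_aux.
  2:{ unfold coefP. rewrite PS_mult_theta_0. unfold Rdiv. ring. }
  unfold Rdiv at 1. rewrite Rmult_assoc. f_equal.
  unfold pFq. rewrite <- Series_scal_l. apply Series_ext. intros m.
  unfold PS_decr_1. rewrite (coefP_S b m hb). simpl poch_prod.
  rewrite Rpow_mult_distr, !poch_2_fact, poch_1_fact, fact_S_R.
  pose proof (poch_duplication 1 m) as e.
  replace (1 + 1 / 2) with (3 / 2) in e by field. rewrite Rmult_1_r in e.
  rewrite poch_1_fact, poch_2_fact, fact_S_R in e.
  assert (poch (2 - b) m <> 0) by now apply poch_noninteger, noninteger_2_minus.
  assert (poch (1 + b) m <> 0)
    by (rewrite Rplus_comm; now apply poch_noninteger, (noninteger_shift b 1)).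
  pose proof (INR_fact_neq_0 m). pose proof (INR_S_neq_0 m).
  assert (e' : poch (2 + INR m) m = poch (3 / 2) m * 4 ^ m / (INR m + 1)).
  { apply Rmult_eq_reg_l with ((INR m + 1) * INR (fact m)).
    - rewrite <- e. field. assumption.
    - now apply Rmult_integral_contrapositive_currified. }
  rewrite e'. field. auto 10.
Qed.

Lemma PSeries_coefQ (b x : R) :
  noninteger b ->
  PSeries (coefQ b) x = x / (b ^ 2 * (1 - b)) * PSeries (coef2F3 b) x.
Proof.
  intros hb. rewrite PSeries_decr_1_aux.
  2:{ unfold coefQ. rewrite PS_mult_theta_0. unfold Rdiv. ring. }
  unfold Rdiv. rewrite Rmult_assoc. f_equal.
  rewrite <- PSeries_scal. apply PSeries_ext. intros m.
  unfold PS_decr_1, PS_scal, scal; simpl; unfold mult; simpl.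
  rewrite (coefQ_S b m hb). unfold Rdiv. simpl. ring.
Qed.

Lemma pFq_coef2F3 (b x : R) :
  noninteger b -> (forall k, poch (2 * b) k <> 0) ->
  pFq [b; 1 / 2 + b] [2 * b; 1 + b; 1 + b] (4 * x) = PSeries (coef2F3 b) x.
Proof.
  intros hb h2. apply Series_ext. intros m. unfold coef2F3. simpl poch_prod.
  rewrite Rpow_mult_distr, (Rplus_comm (1 / 2)).
  pose proof (poch_duplication b m) as e.
  assert (poch (1 + b) m <> 0)
    by (rewrite Rplus_comm; now apply poch_noninteger, (noninteger_shift b 1)).
  pose proof (h2 m). pose proof (INR_fact_neq_0 m).
  replace (poch (2 * b + INR m) m)
    with (poch b m * poch (b + 1 / 2) m * 4 ^ m / poch (2 * b) m)
    by (rewrite e; field; assumption).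
  field. auto.
Qed.

Lemma PS_mult_exp (r s : R) (n : nat) :
  PS_mult (fun k => r ^ k / INR (fact k)) (fun k => s ^ k / INR (fact k)) n =
  (r + s) ^ n / INR (fact n).
Proof.
  rewrite binomial. unfold PS_mult, Rdiv.
  rewrite (Rmult_comm (sum_f_R0 _ _)), scal_sum. apply sum_eq. intros i hi.
  unfold Binomial.C. field. auto using INR_fact_neq_0.
Qed.

Lemma PS_mult_dominated (c d c' d' : nat -> R) (n : nat) :
  (forall k, Rabs (c k) <= c' k) -> (forall k, Rabs (d k) <= d' k) ->
  Rabs (PS_mult c d n) <= PS_mult c' d' n.
Proof.
  intros hc hd. eapply Rle_trans; [apply Rabs_PS_mult_le |].
  apply sum_Rle. intros k _.
  apply Rmult_le_compat; auto using Rabs_pos.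
Qed.

Lemma continuous_poch (f : R -> R) (t : R) (n : nat) :
  continuous f t -> continuous (fun s => poch (f s) n) t.
Proof.
  intros hf. induction n as [|n IH]; simpl; [apply continuous_const |].
  apply (continuous_mult (K := R_AbsRing)); [exact IH |].
  apply (continuous_plus (V := R_NormedModule)); [exact hf | apply continuous_const].
Qed.

Lemma continuous_coef2F3 (b : R) (m : nat) :
  noninteger b -> continuous (fun s => coef2F3 s m) b.
Proof.
  intros hb.
  assert (h1 : poch (1 + b) m <> 0)
    by (rewrite Rplus_comm; now apply poch_noninteger, (noninteger_shift b 1)).
  unfold coef2F3. apply (continuous_mult (K := R_AbsRing)).
  - apply continuous_poch.
    apply (continuous_plus (V := R_NormedModule)); [| apply continuous_const].
    apply (continuous_scal_r (V := R_NormedModule)), continuous_id.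
  - apply continuous_Rinv_comp.
    + apply (continuous_mult (K := R_AbsRing)); [apply continuous_const |].
      assert (hp : continuous (fun s => poch (1 + s) m) b).
      { apply continuous_poch.
        apply (continuous_plus (V := R_NormedModule)); [apply continuous_const | apply continuous_id]. }
      simpl. apply (continuous_mult (K := R_AbsRing)); [exact hp |].
      apply (continuous_mult (K := R_AbsRing)); [exact hp | apply continuous_const].
    + apply Rmult_integral_contrapositive_currified; [apply INR_fact_neq_0 |].
      now apply pow_nonzero.
Qed.

(** For s within eta of b the coefficients are bounded by a constant times (2 /
    eta)^m / m!. *)
Lemma coef2F3_limit (b x : R) :
  noninteger b -> is_lim (fun s => PSeries (coef2F3 s) x) b (PSeries (coef2F3 b) x).
Proof.
  intros hb. destruct (noninteger_gap b hb) as [eta [heta h]].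
  apply (@tannery R (locally' b) (Rbar_locally'_filter b)) with (N := O)
    (M := fun m => (Rabs b + eta) * / eta * ((2 * / eta) ^ m / INR (fact m) * Rabs x ^ m)).
  - apply (ex_series_scal_l ((Rabs b + eta) * / eta)
      (fun m => (2 * / eta) ^ m / INR (fact m) * Rabs x ^ m)).
    apply entire_ex_series, entire_exp.
  - intros m.
    assert (hc : continuous (fun s => coef2F3 s m * x ^ m) b).
    { apply (continuous_mult (K := R_AbsRing)); [| apply continuous_const].
      now apply continuous_coef2F3. }
    intros P hP. destruct (hc P hP) as [d hd]. exists d. intros y hy _. now apply hd.
  - exists (mkposreal eta heta). intros s hs _ m _.
    change (Rabs (s - b) < eta) in hs.
    assert (hk : forall k : Z, eta <= Rabs (s + IZR k)) by (apply h; lra).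
    assert (hn : noninteger s).
    { intros k e. specialize (hk (- k)%Z). rewrite e, opp_IZR, Rplus_opp_r, Rabs_R0 in hk. lra. }
    rewrite (coef2F3_hyp0F1 s m hn), !Rabs_mult, RPow_abs.
    rewrite <- (Rmult_assoc ((Rabs b + eta) * / eta)).
    apply Rmult_le_compat_r; [apply Rabs_pos |].
    apply Rmult_le_compat; try apply Rabs_pos.
    + unfold Rdiv. rewrite Rabs_mult, Rabs_inv, INR_IZR_INZ.
      apply Rmult_le_compat; try apply Rabs_pos.
      * left. apply Rinv_0_lt_compat. specialize (hk (Z.of_nat m)). lra.
      * replace s with (b + (s - b)) by ring. eapply Rle_trans; [apply Rabs_triang |].
        apply Rplus_le_compat_l. left. exact hs.
      * apply Rinv_le_contravar; auto.
    + replace (2 * / eta) with (/ eta + / eta) by ring. rewrite <- PS_mult_exp.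
      apply PS_mult_dominated; intros k; apply hyp0F1_dominated; try exact heta; intros j.
      * rewrite INR_IZR_INZ. apply hk.
      * replace (s + 1 + INR j) with (s + IZR (1 + Z.of_nat j)); [apply hk |].
        rewrite plus_IZR, INR_IZR_INZ. ring.
Qed.

(** If 2b is a nonpositive integer, then 2s is not an integer for the other s near
    b, where the hypergeometric series has the simplified coefficients; their sum is
    continuous in s. *)
Lemma pFq_at_coef2F3 (b x : R) :
  noninteger b ->
  pFq_at (fun t => [t; 1 / 2 + t]) (fun t => [2 * t; 1 + t; 1 + t]) b (4 * x) =
  PSeries (coef2F3 b) x.
Proof.
  intros hb. unfold pFq_at.
  destruct (excluded_middle_informative _) as [hex | hex].
  - assert (hl : is_lim (fun s => pFq [s; 1 / 2 + s] [2 * s; 1 + s; 1 + s] (4 * x)) b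
                        (PSeries (coef2F3 b) x)).
    2:{ now rewrite (is_lim_unique _ _ _ hl). }
    assert (hint : exists m : Z, 2 * b = IZR m).
    { rewrite !Exists_cons in hex. destruct hex as [[n e] | [[n e] | [[n e] | e]]].
      - exists (- Z.of_nat n)%Z. now rewrite opp_IZR, <- INR_IZR_INZ.
      - exfalso. apply (noninteger_plus_INR (b + IZR 1) n); [now apply noninteger_shift |]. lra.
      - exfalso. apply (noninteger_plus_INR (b + IZR 1) n); [now apply noninteger_shift |]. lra.
      - now apply Exists_nil in e. }
    destruct hint as [m hm].
    destruct (noninteger_gap b hb) as [eta [heta h]].
    eapply is_lim_ext_loc; [| now apply coef2F3_limit].
    assert (hr : 0 < Rmin eta (1 / 2)) by (apply Rmin_pos; lra).
    exists (mkposreal _ hr). intros s hs hne.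
    change (Rabs (s - b) < Rmin eta (1 / 2)) in hs.
    pose proof (Rmin_l eta (1 / 2)). pose proof (Rmin_r eta (1 / 2)).
    symmetry. apply pFq_coef2F3.
    + intros k e. specialize (h s ltac:(lra) (- k)%Z).
      rewrite e, opp_IZR, Rplus_opp_r, Rabs_R0 in h. lra.
    + intros k. apply poch_neq_0. intros j _ e.
      apply hne.
      (* 2s = - j and 2b = m are integers at distance less than 1. *)
      assert (e' : (- Z.of_nat j = m)%Z).
      { apply Z.le_antisymm; apply Z.lt_succ_r, lt_IZR; rewrite succ_IZR;
          rewrite opp_IZR, <- INR_IZR_INZ; apply Rabs_lt_between in hs; lra. }
      apply (f_equal IZR) in e'. rewrite opp_IZR, <- INR_IZR_INZ in e'. lra.
  - apply pFq_coef2F3; [exact hb |]. intros k. apply poch_neq_0. intros j _ e.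
    apply hex. left. exists j. lra.
Qed.

(** * The Gamma and digamma functions on the real line *)

Definition Gauss_seq (z : R) (n : nat) : R :=
  INR (fact n) * Rpower (INR n) z / poch z (S n).

(** The jth factor of Euler's product for z Gamma(z), on a logarithmic scale. *)
Definition ln_Gamma_term (z : R) (j : nat) : R :=
  z * ln (1 + / (INR j + 1)) - ln (1 + z / (INR j + 1)).

Definition digamma_term (z : R) (j : nat) : R :=
  ln (1 + / (INR j + 1)) - / (z + (INR j + 1)).

Definition ln_Gamma (z : R) : R := - ln z + Series (ln_Gamma_term z).

Definition digamma_series (z : R) : R := - / z + Series (digamma_term z).

Lemma is_lim_seq_inv_INR_plus (c : R) : is_lim_seq (fun n => / (INR n + c)) 0.
Proof.
  apply (is_lim_seq_inv (fun n => INR n + c) p_infty); [| discriminate].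
  apply is_lim_seq_plus with p_infty c; [apply is_lim_seq_INR | apply is_lim_seq_const |].
  reflexivity.
Qed.

Lemma is_series_inv_consecutive : is_series (fun j => / ((INR j + 1) * (INR j + 2))) 1.
Proof.
  assert (h : is_lim_seq (fun n => 1 - / (INR n + 2)) 1).
  { replace (Finite 1) with (Finite (1 - 0)) by (f_equal; ring).
    apply is_lim_seq_minus'; [apply is_lim_seq_const | apply is_lim_seq_inv_INR_plus]. }
  apply (is_lim_seq_ext _ (sum_n (fun j => / ((INR j + 1) * (INR j + 2))))) in h; [exact h |].
  intros n. rewrite sum_n_Reals. induction n as [|n IH].
  - simpl. field.
  - rewrite tech5, <- IH, S_INR. pose proof (pos_INR n). field. lra.
Qed.

(** A summable majorant of 1 / (j + 1)^2 whose sum is elementary. *)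
Definition telescoping (j : nat) : R := 2 * / ((INR j + 1) * (INR j + 2)).

Lemma is_series_telescoping : is_series telescoping 2.
Proof.
  rewrite <- (Rmult_1_r 2). exact (is_series_scal_l 2 _ _ is_series_inv_consecutive).
Qed.

Lemma ln_1_plus_bounds (u : R) : 0 <= u -> u / (1 + u) <= ln (1 + u) <= u.
Proof.
  intros hu. split.
  - assert (h : ln (/ (1 + u)) <= / (1 + u) - 1).
    { assert (0 < / (1 + u)) by (apply Rinv_0_lt_compat; lra).
      pose proof (exp_ineq1_le (ln (/ (1 + u)))) as e. rewrite exp_ln in e by assumption. lra. }
    rewrite ln_Rinv in h by lra.
    replace (u / (1 + u)) with (1 - / (1 + u)) by (field; lra). lra.
  - pose proof (exp_ineq1_le (ln (1 + u))) as e. rewrite exp_ln in e by lra. lra.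
Qed.

(** Both ln (1 + 1/m) and 1 / (z + m) lie within O(1/m^2) of 1/m. *)
Lemma digamma_term_bound (z : R) (j : nat) :
  0 <= z -> Rabs (digamma_term z j) <= (z + 1) * telescoping j.
Proof.
  intros hz. unfold digamma_term, telescoping. pose proof (pos_INR j) as hj.
  set (m := INR j + 1). replace (INR j + 2) with (m + 1) by (unfold m; ring).
  assert (hm : 1 <= m) by (unfold m; lra).
  assert (hi : 0 < / m) by (apply Rinv_0_lt_compat; lra).
  destruct (ln_1_plus_bounds (/ m) ltac:(lra)) as [l1 l2].
  replace (/ m / (1 + / m)) with (/ m - / (m * (m + 1))) in l1 by (field; lra).
  assert (h1 : 0 < / (m * (m + 1))) by (apply Rinv_0_lt_compat, Rmult_lt_0_compat; lra).
  assert (h2 : 0 <= / m - / (z + m) <= z * (2 * / (m * (m + 1)))).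
  { replace (/ m - / (z + m)) with (z * / (m * (z + m))) by (field; lra).
    assert (h3 : 0 < / (m * (z + m))) by (apply Rinv_0_lt_compat, Rmult_lt_0_compat; lra).
    split; [apply Rmult_le_pos; lra |].
    apply Rmult_le_compat_l; [exact hz |].
    replace (2 * / (m * (m + 1))) with (/ (m * ((m + 1) / 2))) by (field; lra).
    apply Rinv_le_contravar; [apply Rmult_lt_0_compat; lra |].
    apply Rmult_le_compat_l; lra. }
  apply Rabs_le_between. lra.
Qed.

Lemma is_derive_ln_Gamma_term (z : R) (j : nat) :
  0 <= z -> is_derive (fun t => ln_Gamma_term t j) z (digamma_term z j).
Proof.
  intros hz. unfold ln_Gamma_term, digamma_term. pose proof (pos_INR j) as hj.
  assert (h : 0 <= z / (INR j + 1)) by (apply Rdiv_le_0_compat; lra).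
  auto_derive.
  - unfold Rdiv in h. lra.
  - field. lra.
Qed.

Lemma ln_Gamma_term_lipschitz (Z y z : R) (j : nat) :
  0 <= y <= Z -> 0 <= z <= Z ->
  Rabs (ln_Gamma_term y j - ln_Gamma_term z j) <= (Z + 1) * telescoping j * Rabs (y - z).
Proof.
  intros hy hz.
  assert (hw : 0 < telescoping j).
  { unfold telescoping. pose proof (pos_INR j).
    apply Rmult_lt_0_compat; [lra |]. apply Rinv_0_lt_compat, Rmult_lt_0_compat; lra. }
  destruct (MVT_gen (fun t => ln_Gamma_term t j) z y (fun t => digamma_term t j)) as [c [hc e]].
  - intros t [ht _]. apply is_derive_ln_Gamma_term.
    pose proof (Rmin_glb z y 0 (proj1 hz) (proj1 hy)). lra.
  - intros t [ht _]. apply derivable_continuous_pt. exists (digamma_term t j).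
    apply is_derive_Reals, is_derive_ln_Gamma_term.
    pose proof (Rmin_glb z y 0 (proj1 hz) (proj1 hy)). lra.
  - rewrite e, Rabs_mult. apply Rmult_le_compat_r; [apply Rabs_pos |].
    pose proof (Rmin_glb z y 0 (proj1 hz) (proj1 hy)).
    pose proof (Rmax_lub z y Z (proj2 hz) (proj2 hy)).
    eapply Rle_trans; [apply digamma_term_bound; lra |].
    apply Rmult_le_compat_r; lra.
Qed.

Lemma ln_Gamma_term_0 (j : nat) : ln_Gamma_term 0 j = 0.
Proof.
  unfold ln_Gamma_term, Rdiv. rewrite !Rmult_0_l, Rplus_0_r, ln_1. ring.
Qed.

Lemma ln_Gamma_term_bound (z : R) (j : nat) :
  0 <= z -> Rabs (ln_Gamma_term z j) <= (z + 1) * z * telescoping j.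
Proof.
  intros hz. pose proof (ln_Gamma_term_lipschitz z z 0 j ltac:(lra) ltac:(lra)) as h.
  rewrite ln_Gamma_term_0, !Rminus_0_r, (Rabs_pos_eq z hz) in h. lra.
Qed.

Lemma ex_series_scal_telescoping (K : R) : ex_series (fun j => K * telescoping j).
Proof. apply (ex_series_scal_l K telescoping). now exists 2; apply is_series_telescoping. Qed.

Lemma Series_scal_telescoping (K : R) : Series (fun j => K * telescoping j) = 2 * K.
Proof.
  rewrite Series_scal_l, (is_series_unique _ _ is_series_telescoping). ring.
Qed.

Lemma ex_series_ln_Gamma (z : R) : 0 <= z -> ex_series (ln_Gamma_term z).
Proof.
  intros hz. apply ex_series_dominated with (fun j => (z + 1) * z * telescoping j).
  - intros j. now apply ln_Gamma_term_bound.
  - apply ex_series_scal_telescoping.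
Qed.

Lemma Gauss_seq_S (z : R) (n : nat) :
  0 < z ->
  Gauss_seq z (S n) =
  exp (- ln z + sum_f_R0 (ln_Gamma_term z) n) * exp (z * - ln (1 + / (INR n + 1))).
Proof.
  intros hz. rewrite <- exp_plus.
  assert (hp : forall k, 0 < poch z k) by (intros k; now apply poch_pos).
  assert (hg : forall k, 0 < z + INR k) by (intros k; pose proof (pos_INR k); lra).
  unfold Gauss_seq.
  replace (INR (fact (S n)) * Rpower (INR (S n)) z / poch z (S (S n)))
    with (exp (ln (INR (fact (S n)) / poch z (S (S n))) + z * ln (INR (S n)))).
  2:{ rewrite exp_plus, exp_ln; [unfold Rpower; field; apply Rgt_not_eq, hp |].
      apply Rdiv_lt_0_compat; [apply INR_fact_lt_0 | apply hp]. }
  f_equal.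
  induction n as [|n IH].
  - replace (INR (fact 1) / poch z 2) with (/ (z * (1 + z))) by (simpl; field; lra).
    rewrite ln_Rinv by (apply Rmult_lt_0_compat; lra).
    rewrite ln_mult by lra. simpl. unfold ln_Gamma_term. simpl INR.
    rewrite !Rplus_0_l, Rinv_1, ln_1, Rdiv_1_r. ring.
  - rewrite tech5.
    assert (hn : 0 < INR n + 1) by (pose proof (pos_INR n); lra).
    assert (e : ln (INR (fact (S (S n))) / poch z (S (S (S n)))) =
      ln (INR (fact (S n)) / poch z (S (S n))) - ln (1 + z / (INR (S n) + 1))).
    { rewrite <- ln_div.
      - f_equal. rewrite (fact_S_R (S n)).
        change (poch z (S (S (S n)))) with (poch z (S (S n)) * (z + INR (S (S n)))).
        rewrite (S_INR (S n)). rewrite S_INR. field.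
        repeat split; try lra. apply Rgt_not_eq, hp.
      - apply Rdiv_lt_0_compat; [apply INR_fact_lt_0 | apply hp].
      - rewrite S_INR. assert (0 < z / (INR n + 1 + 1)) by (apply Rdiv_lt_0_compat; lra). lra. }
    rewrite e. unfold ln_Gamma_term at 2.
    assert (e2 : ln (INR (S (S n))) = ln (INR (S n)) + ln (1 + / (INR n + 1))).
    { rewrite <- ln_mult.
      - f_equal. rewrite !S_INR. field. lra.
      - rewrite S_INR. lra.
      - assert (0 < / (INR n + 1)) by now apply Rinv_0_lt_compat. lra. }
    rewrite e2. lra.
Qed.

Lemma Gauss_seq_pos_lim (z : R) :
  0 < z -> is_lim_seq (Gauss_seq z) (exp (ln_Gamma z)).
Proof.
  intros hz. apply is_lim_seq_incr_1.
  apply is_lim_seq_ext with (fun n =>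
    exp (- ln z + sum_f_R0 (ln_Gamma_term z) n) * exp (z * - ln (1 + / (INR n + 1)))).
  { intros n. symmetry. now apply Gauss_seq_S. }
  replace (Finite (exp (ln_Gamma z))) with (Finite (exp (ln_Gamma z) * exp (z * - ln (1 + 0))))
    by (rewrite Rplus_0_r, ln_1, Ropp_0, Rmult_0_r, exp_0; f_equal; ring).
  apply is_lim_seq_mult'.
  - apply is_lim_seq_continuous; [apply derivable_continuous_pt, derivable_pt_exp |].
    apply is_lim_seq_plus'; [apply is_lim_seq_const |].
    apply is_lim_seq_ext with (sum_n (ln_Gamma_term z)); [apply sum_n_Reals |].
    apply Series_correct, ex_series_ln_Gamma. lra.
  - apply (is_lim_seq_continuous (fun u => exp (z * - ln (1 + u)))).
    + apply derivable_continuous_pt, ex_derive_Reals_0. auto_derive. lra.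
    + apply is_lim_seq_inv_INR_plus.
Qed.

Lemma is_derive_ln_Gamma (z : R) : 0 < z -> is_derive ln_Gamma z (digamma_series z).
Proof.
  intros hz. apply (is_derive_plus (V := R_NormedModule)).
  - auto_derive; [exact hz | ring].
  - apply is_derive_Series with (M := fun j => (2 * z + 1) * telescoping j) (N := O).
    + apply ex_series_scal_telescoping.
    + apply ex_series_ln_Gamma. lra.
    + intros j. apply is_derive_ln_Gamma_term. lra.
    + exists (mkposreal z hz). intros y hy j _.
      change (Rabs (y - z) < z) in hy. apply Rabs_lt_between in hy.
      apply ln_Gamma_term_lipschitz; lra.
Qed.

Lemma digamma_series_bound (z : R) : 0 < z -> Rabs (digamma_series z) <= / z + 2 * (z + 1).
Proof.
  intros hz. unfold digamma_series. eapply Rle_trans; [apply Rabs_triang |].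
  apply Rplus_le_compat.
  - rewrite Rabs_Ropp, Rabs_pos_eq; [lra |]. left. now apply Rinv_0_lt_compat.
  - rewrite <- Series_scal_telescoping. apply Rabs_Series_le; [| apply ex_series_scal_telescoping].
    intros j. apply digamma_term_bound. lra.
Qed.

(** Any explicit constant would do; 13 is 1 for the logarithm plus 2 * (2 + 1) * 2
    for the series. *)
Lemma ln_Gamma_bound (z : R) : 1 <= z <= 2 -> Rabs (ln_Gamma z) <= 13.
Proof.
  intros hz. unfold ln_Gamma. eapply Rle_trans; [apply Rabs_triang |].
  destruct (ln_1_plus_bounds (z - 1) ltac:(lra)) as [l1 l2].
  replace (1 + (z - 1)) with z in l1, l2 by ring.
  assert (h0 : 0 <= (z - 1) / z) by (apply Rdiv_le_0_compat; lra).
  rewrite Rabs_Ropp, Rabs_pos_eq by lra.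
  assert (h : Rabs (Series (ln_Gamma_term z)) <= 2 * ((z + 1) * z)).
  { rewrite <- Series_scal_telescoping. apply Rabs_Series_le; [| apply ex_series_scal_telescoping].
    intros j. apply ln_Gamma_term_bound. lra. }
  nra.
Qed.

Lemma Gamma_lim (z l : R) : is_lim_seq (Gauss_seq z) l -> Gamma z = l.
Proof.
  intros h. unfold Gamma. fold (Gauss_seq z). now rewrite (is_lim_seq_unique _ _ h).
Qed.

Lemma Gamma_exp_ln_Gamma (z : R) : 0 < z -> Gamma z = exp (ln_Gamma z).
Proof. intros hz. apply Gamma_lim. now apply Gauss_seq_pos_lim. Qed.

Definition nonpole (z : R) : Prop := forall n : nat, z + INR n <> 0.

Lemma nonpole_succ (z : R) : nonpole z -> nonpole (z + 1).
Proof. intros h n e. apply (h (S n)). rewrite S_INR. lra. Qed.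

Lemma nonpole_neq_0 (z : R) : nonpole z -> z <> 0.
Proof. intros h e. apply (h O). simpl. lra. Qed.

Lemma nonpole_pos (z : R) : 0 < z -> nonpole z.
Proof. intros h n. pose proof (pos_INR n). lra. Qed.

Lemma nonpole_poch (z : R) (n : nat) : nonpole z -> poch z n <> 0.
Proof. intros h. apply poch_neq_0. intros k _. apply h. Qed.

(** Induction from the positive half-line downwards, following the functional
    equation. *)
Lemma nonpole_ind (P : R -> Prop) :
  (forall z, 0 < z -> P z) ->
  (forall z, nonpole z -> P (z + 1) -> P z) ->
  forall z, nonpole z -> P z.
Proof.
  intros h0 hS z hz.
  destruct (INR_archimed 1 (- z) Rlt_0_1) as [n hn]. rewrite Rmult_1_r in hn.
  revert z hz hn. induction n as [|n IH]; intros z hz hn.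
  - apply h0. simpl in hn. lra.
  - apply hS; [exact hz |]. apply IH; [now apply nonpole_succ |]. rewrite S_INR in hn. lra.
Qed.

(** The exact form of the functional equation for the approximants; the last factor
    tends to 1. The summand 0 gives 1 / n the shape of [is_lim_seq_inv_INR_plus]. *)
Lemma Gauss_seq_shift (z : R) (n : nat) :
  nonpole z -> (0 < n)%nat ->
  Gauss_seq (z + 1) n * / z * (1 + (z + 1) * / (INR n + 0)) = Gauss_seq z n.
Proof.
  intros hz hn. unfold Gauss_seq.
  assert (h : 0 < INR n) by now apply lt_0_INR.
  rewrite Rpower_plus, Rpower_1 by exact h. rewrite Rplus_0_r.
  pose proof (nonpole_neq_0 z hz) as h0.
  pose proof (poch_S_l z (S n)) as e.
  pose proof (nonpole_poch (z + 1) (S n) (nonpole_succ z hz)) as h1.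
  pose proof (nonpole_poch z (S n) hz) as h2.
  change (poch z (S (S n))) with (poch z (S n) * (z + INR (S n))) in e. rewrite S_INR in e.
  pose proof (hz (S n)) as h3. rewrite S_INR in h3.
  replace (poch (z + 1) (S n)) with (poch z (S n) * (z + (INR n + 1)) / z)
    by (rewrite e; field; exact h0).
  field. repeat split; try assumption; lra.
Qed.

Lemma Gauss_seq_lim_pred (z l : R) :
  nonpole z -> is_lim_seq (Gauss_seq (z + 1)) l -> is_lim_seq (Gauss_seq z) (l / z).
Proof.
  intros hz h. replace (l / z) with (l * / z * (1 + (z + 1) * 0)) by (unfold Rdiv; ring).
  apply is_lim_seq_ext_loc with
    (fun n => Gauss_seq (z + 1) n * / z * (1 + (z + 1) * / (INR n + 0))).
  { exists 1%nat. intros n hn. now apply Gauss_seq_shift. }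
  apply is_lim_seq_mult'.
  - apply is_lim_seq_mult'; [exact h | apply is_lim_seq_const].
  - apply is_lim_seq_plus'; [apply is_lim_seq_const |].
    apply is_lim_seq_mult'; [apply is_lim_seq_const | apply is_lim_seq_inv_INR_plus].
Qed.

Lemma Gauss_seq_lim (z : R) :
  nonpole z -> exists l, l <> 0 /\ is_lim_seq (Gauss_seq z) l.
Proof.
  revert z. apply nonpole_ind.
  - intros z hz. exists (exp (ln_Gamma z)).
    split; [apply Rgt_not_eq, exp_pos | now apply Gauss_seq_pos_lim].
  - intros z hz [l [hl h]]. exists (l / z). split; [| now apply Gauss_seq_lim_pred].
    apply Rmult_integral_contrapositive_currified; [exact hl |].
    now apply Rinv_neq_0_compat, nonpole_neq_0.
Qed.

Lemma Gamma_neq_0 (z : R) : nonpole z -> Gamma z <> 0.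
Proof.
  intros hz. destruct (Gauss_seq_lim z hz) as [l [hl h]]. now rewrite (Gamma_lim z l h).
Qed.

Lemma Gamma_succ (z : R) : nonpole z -> Gamma (z + 1) = z * Gamma z.
Proof.
  intros hz. destruct (Gauss_seq_lim (z + 1) (nonpole_succ z hz)) as [l [hl h]].
  rewrite (Gamma_lim (z + 1) l h).
  rewrite (Gamma_lim z _ (Gauss_seq_lim_pred z l hz h)). field. now apply nonpole_neq_0.
Qed.

Lemma Gamma_plus_INR (z : R) (n : nat) :
  nonpole z -> Gamma (z + INR n) = poch z n * Gamma z.
Proof.
  intros hz. induction n as [|n IH]; [simpl; rewrite Rplus_0_r; ring |].
  rewrite S_INR, <- Rplus_assoc, Gamma_succ.
  - rewrite IH. simpl. ring.
  - intros k. rewrite Rplus_assoc, <- plus_INR. apply hz.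
Qed.

Lemma locally_nonpole (z : R) : nonpole z -> locally z nonpole.
Proof.
  revert z. apply nonpole_ind.
  - intros z hz. generalize (open_gt 0 z hz). apply filter_imp. apply nonpole_pos.
  - intros z hz [d hd].
    generalize (filter_and _ _ (open_neq 0 z (nonpole_neq_0 z hz)) (locally_ball z d)).
    apply filter_imp. intros y [h1 h2] n.
    destruct n as [|n]; [simpl; intros e; apply h1; change (y + 0 = 0) in e; lra |].
    assert (h3 : ball (z + 1) d (y + 1)).
    { change (Rabs (y + 1 - (z + 1)) < d). change (Rabs (y - z) < d) in h2.
      now replace (y + 1 - (z + 1)) with (y - z) by (simpl; ring). }
    pose proof (hd _ h3 n) as h4. rewrite S_INR. intros e. apply h4. simpl in *. lra.
Qed.

Lemma is_derive_Gamma_pos (z : R) : 0 < z -> is_derive Gamma z (Gamma z * digamma_series z).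
Proof.
  intros hz. apply is_derive_ext_loc with (fun t => exp (ln_Gamma t)).
  - generalize (open_gt 0 z hz). apply filter_imp. intros t ht. symmetry.
    now apply Gamma_exp_ln_Gamma.
  - rewrite Gamma_exp_ln_Gamma by exact hz. rewrite Rmult_comm.
    apply (is_derive_comp exp ln_Gamma); [apply is_derive_Reals, derivable_pt_lim_exp |].
    now apply is_derive_ln_Gamma.
Qed.

Lemma digamma_digamma_series (z : R) : 0 < z -> digamma z = digamma_series z.
Proof.
  intros hz. unfold digamma. rewrite (is_derive_unique _ _ _ (is_derive_Gamma_pos z hz)).
  field. now apply Gamma_neq_0, nonpole_pos.
Qed.

Lemma is_derive_Gamma_pred (z d : R) :
  nonpole z -> is_derive Gamma (z + 1) d -> is_derive Gamma z ((d - Gamma z) / z).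
Proof.
  intros hz hd. pose proof (nonpole_neq_0 z hz) as h0.
  assert (e : forall t, nonpole t -> Gamma (t + 1) / t = Gamma t)
    by (intros t ht; rewrite (Gamma_succ t ht); field; now apply nonpole_neq_0).
  apply is_derive_ext_loc with (fun t => Gamma (t + 1) / t).
  - generalize (locally_nonpole z hz). apply filter_imp. exact e.
  - assert (h1 : is_derive (fun t => Gamma (t + 1)) z d).
    { rewrite <- (Rmult_1_l d). apply (is_derive_comp Gamma (fun t => t + 1)); [exact hd |].
      auto_derive; auto. }
    replace ((d - Gamma z) / z) with ((d * z - 1 * Gamma (z + 1)) / z ^ 2)
      by (rewrite (Gamma_succ z hz); field; exact h0).
    replace (1 * Gamma (z + 1)) with (Gamma (z + 1) * 1) by ring.
    apply (is_derive_div (fun t => Gamma (t + 1)) (fun t => t) z d 1);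
      [exact h1 | apply (is_derive_id (K := R_AbsRing)) | exact h0].
Qed.

Lemma ex_derive_Gamma (z : R) : nonpole z -> ex_derive Gamma z.
Proof.
  revert z. apply nonpole_ind.
  - intros z hz. exists (Gamma z * digamma_series z). now apply is_derive_Gamma_pos.
  - intros z hz [d hd]. exists ((d - Gamma z) / z). now apply is_derive_Gamma_pred.
Qed.

Lemma digamma_succ (z : R) : nonpole z -> digamma (z + 1) = digamma z + / z.
Proof.
  intros hz. unfold digamma.
  pose proof (Derive_correct _ _ (ex_derive_Gamma _ (nonpole_succ z hz))) as h.
  rewrite (is_derive_unique _ _ _ (is_derive_Gamma_pred z _ hz h)), (Gamma_succ z hz).
  field. split; [now apply nonpole_neq_0 | now apply Gamma_neq_0].
Qed.

Lemma is_derive_inv_Gamma (z : R) :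
  nonpole z -> is_derive (fun t => / Gamma t) z (- (digamma z / Gamma z)).
Proof.
  intros hz. pose proof (Gamma_neq_0 z hz) as h0.
  replace (- (digamma z / Gamma z)) with (- Derive Gamma z / Gamma z ^ 2)
    by (unfold digamma; field; exact h0).
  apply is_derive_inv; [now apply Derive_correct, ex_derive_Gamma | exact h0].
Qed.

Lemma Gamma_pos (z : R) : 0 < z -> 0 < Gamma z.
Proof. intros hz. rewrite Gamma_exp_ln_Gamma by exact hz. apply exp_pos. Qed.

(** From [1, 2] the bound propagates upwards since Gamma (z + 1) = z Gamma z >=
    Gamma z for z >= 1. *)
Lemma inv_Gamma_bound (z : R) : 1 <= z -> / Gamma z <= exp 13.
Proof.
  intros hz. destruct (INR_archimed 1 (z - 2) Rlt_0_1) as [n hn]. rewrite Rmult_1_r in hn.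
  revert z hz hn. induction n as [|n IH]; intros z hz hn.
  - simpl in hn. rewrite Gamma_exp_ln_Gamma, <- exp_Ropp by lra.
    pose proof (ln_Gamma_bound z ltac:(lra)) as h. apply Rabs_le_between in h.
    apply Rnot_lt_le.
    intros h'. apply exp_lt_inv in h'. lra.
  - rewrite S_INR in hn. destruct (Rlt_or_le z 2) as [h | h].
    + apply IH; [exact hz |]. pose proof (pos_INR n). lra.
    + specialize (IH (z - 1) ltac:(lra) ltac:(lra)).
      replace z with (z - 1 + 1) by ring. rewrite Gamma_succ by (apply nonpole_pos; lra).
      rewrite Rinv_mult.
      assert (0 < / Gamma (z - 1)) by (apply Rinv_0_lt_compat, Gamma_pos; lra).
      assert (/ (z - 1) <= / 1) by (apply Rinv_le_contravar; lra).
      assert (0 < / (z - 1)) by (apply Rinv_0_lt_compat; lra).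
      nra.
Qed.

(** The linear growth of the bound on psi is absorbed by 1 / Gamma z = 1 / ((z - 1)
    Gamma (z - 1)); the quotient (1/z + 2 (z + 1)) / (z - 1) is at most 7 for z >=
    2. *)
Lemma digamma_div_Gamma_bound (z : R) :
  2 <= z -> Rabs (digamma z / Gamma z) <= 7 * exp 13.
Proof.
  intros hz. rewrite digamma_digamma_series by lra.
  replace z with (z - 1 + 1) at 2 by ring. rewrite Gamma_succ by (apply nonpole_pos; lra).
  assert (h1 : 0 < / Gamma (z - 1)) by (apply Rinv_0_lt_compat, Gamma_pos; lra).
  pose proof (inv_Gamma_bound (z - 1) ltac:(lra)) as h2.
  pose proof (digamma_series_bound z ltac:(lra)) as h3.
  assert (h4 : / z <= / 2) by (apply Rinv_le_contravar; lra).
  unfold Rdiv. rewrite Rinv_mult, <- Rmult_assoc, Rabs_mult, (Rabs_pos_eq (/ Gamma _)) by lra.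
  apply Rmult_le_compat; [apply Rabs_pos | lra | | exact h2].
  rewrite Rabs_mult, Rabs_inv, (Rabs_pos_eq (z - 1)) by lra.
  apply Rle_div_l; lra.
Qed.

Lemma inv_Gamma_lipschitz (y z : R) :
  2 <= y -> 2 <= z -> Rabs (/ Gamma y - / Gamma z) <= 7 * exp 13 * Rabs (y - z).
Proof.
  intros hy hz.
  assert (hd : forall t, Rmin z y <= t -> 2 <= t)
    by (intros t ht; pose proof (Rmin_glb z y 2 hz hy); lra).
  destruct (MVT_gen (fun t => / Gamma t) z y (fun t => - (digamma t / Gamma t))) as [c [hc e]].
  - intros t ht. apply is_derive_inv_Gamma, nonpole_pos. specialize (hd t ltac:(lra)). lra.
  - intros t ht. apply derivable_continuous_pt. exists (- (digamma t / Gamma t)).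
    apply is_derive_Reals, is_derive_inv_Gamma, nonpole_pos. specialize (hd t ltac:(lra)). lra.
  - rewrite e, Rabs_mult, Rabs_Ropp. apply Rmult_le_compat_r; [apply Rabs_pos |].
    apply digamma_div_Gamma_bound, hd. lra.
Qed.

(** * Differentiation of the integral Wright function *)

Lemma noninteger_nonpole (b : R) : noninteger b -> nonpole b.
Proof. intros hb n. now apply noninteger_plus_INR. Qed.

Lemma digamma_plus_INR (z : R) (n : nat) :
  nonpole z -> digamma (z + INR n) = digamma z + harmonic z n.
Proof.
  intros hz. induction n as [|n IH]; [simpl; now rewrite !Rplus_0_r |].
  rewrite S_INR, <- Rplus_assoc, digamma_succ.
  - rewrite IH. simpl. ring.
  - intros k. rewrite Rplus_assoc, <- plus_INR. apply hz.
Qed.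

Lemma ex_series_exp_tail (K r : R) :
  ex_series (fun n => K * (r ^ S n / INR (fact (S n)))).
Proof.
  apply (ex_series_scal_l K (fun n => r ^ S n / INR (fact (S n)))).
  apply (ex_series_incr_1 (fun n => r ^ n / INR (fact n))).
  eapply ex_series_ext; [| exact (entire_ex_series _ 1 (entire_exp r))].
  intros n. simpl. rewrite pow1. ring.
Qed.

(** For alpha within 1/2 of 1 and n large, alpha (n + 1) + beta is at least 2, where
    1 / Gamma is Lipschitz; the factor n + 1 from the chain rule cancels the one in
    the series, leaving an exponential series as majorant. The remaining finitely
    many terms only need the derivative at alpha = 1, where the argument is not an
    integer. *)
Lemma is_derive_Wi (beta x : R) :
  noninteger beta ->
  is_derive (fun alpha => Wi alpha beta x) 1
    (Series (fun n => - (x ^ S n / INR (fact (S n)) *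
       (digamma (beta + INR (S n)) / Gamma (beta + INR (S n)))))).
Proof.
  intros hb.
  destruct (INR_archimed 1 (2 * (2 + Rabs beta)) Rlt_0_1) as [N hN].
  rewrite Rmult_1_r in hN.
  assert (large : forall n alpha, (N <= n)%nat -> Rabs (alpha - 1) < 1 / 2 ->
    2 <= alpha * INR (S n) + beta).
  { intros n alpha hn ha. apply le_INR in hn. apply Rabs_lt_between in ha.
    pose proof (Rabs_maj2 beta). rewrite S_INR. pose proof (pos_INR n). nra. }
  assert (eq : forall n alpha, x ^ S n / (INR (S n) * INR (fact (S n)) * Gamma (alpha * INR (S n) + beta))
     = x ^ S n / (INR (S n) * INR (fact (S n))) * / Gamma (alpha * INR (S n) + beta)).
  { intros n alpha. unfold Rdiv. rewrite !Rinv_mult. ring. }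
  assert (affine : forall m, is_derive (fun alpha => alpha * m + beta) 1 m)
    by (intros m; auto_derive; [auto | ring]).
  assert (diff : forall a m, a * m + beta - (1 * m + beta) = m * (a - 1))
    by (intros a m; ring).
  assert (hq : forall n, 0 < INR (S n)) by (intros n; apply lt_0_INR; lia).
  apply is_derive_Series with (N := N)
    (M := fun n => 7 * exp 13 * (Rabs x ^ S n / INR (fact (S n)))).
  - apply ex_series_exp_tail.
  - apply ex_series_dominated_from with (N := N)
      (v := fun n => exp 13 * (Rabs x ^ S n / INR (fact (S n)))).
    + intros n hn. rewrite eq.
      pose proof (large n 1 hn) as h.
      rewrite Rminus_diag, Rabs_R0 in h. specialize (h ltac:(lra)).
      pose proof (inv_Gamma_bound (1 * INR (S n) + beta) ltac:(lra)) as h1.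
      assert (h2 : 0 < / Gamma (1 * INR (S n) + beta))
        by (apply Rinv_0_lt_compat, Gamma_pos; lra).
      rewrite Rabs_mult, (Rabs_pos_eq (/ Gamma _)) by lra.
      rewrite Rmult_comm. apply Rmult_le_compat; [lra | apply Rabs_pos | exact h1 |].
      unfold Rdiv. rewrite Rabs_mult, RPow_abs. apply Rmult_le_compat_l; [apply Rabs_pos |].
      pose proof (INR_fact_lt_0 (S n)).
      rewrite Rabs_pos_eq.
      * apply Rinv_le_contravar; [assumption |].
        rewrite <- (Rmult_1_l (INR (fact (S n)))) at 1. apply Rmult_le_compat_r; [lra |].
        rewrite S_INR. pose proof (pos_INR n). lra.
      * left. apply Rinv_0_lt_compat, Rmult_lt_0_compat; auto.
    + apply ex_series_exp_tail.
  - intros n.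
    apply is_derive_ext with (fun alpha => x ^ S n / (INR (S n) * INR (fact (S n))) *
        / Gamma (alpha * INR (S n) + beta)); [intros alpha; symmetry; apply eq |].
    replace (- (x ^ S n / INR (fact (S n)) *
       (digamma (beta + INR (S n)) / Gamma (beta + INR (S n)))))
      with (x ^ S n / (INR (S n) * INR (fact (S n))) *
        (INR (S n) * - (digamma (1 * INR (S n) + beta) / Gamma (1 * INR (S n) + beta)))).
    + apply is_derive_scal.
      apply (is_derive_comp (fun z => / Gamma z) (fun alpha => alpha * INR (S n) + beta)).
      * apply is_derive_inv_Gamma. rewrite Rmult_1_l, Rplus_comm, INR_IZR_INZ.
        now apply noninteger_nonpole, noninteger_shift.
      * apply affine.
    + rewrite Rmult_1_l, (Rplus_comm beta).
      assert (h : Gamma (INR (S n) + beta) <> 0).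
      { apply Gamma_neq_0. rewrite Rplus_comm, INR_IZR_INZ.
        now apply noninteger_nonpole, noninteger_shift. }
      field. repeat split; auto using INR_fact_neq_0. now apply not_0_INR.
  - assert (h : 0 < 1 / 2) by lra.
    exists (mkposreal _ h). intros alpha ha n hn. change (Rabs (alpha - 1) < 1 / 2) in ha.
    assert (h1 : Rabs (1 - 1) < 1 / 2) by (rewrite Rminus_diag, Rabs_R0; lra).
    pose proof (inv_Gamma_lipschitz _ _ (large n alpha hn ha) (large n 1 hn h1)) as hl.
    rewrite !eq, <- Rmult_minus_distr_l, Rabs_mult.
    rewrite diff in hl.
    rewrite Rabs_mult, (Rabs_pos_eq (INR (S n))) in hl by (left; apply hq).
    eapply Rle_trans; [apply Rmult_le_compat_l; [apply Rabs_pos | exact hl] |].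
    apply Req_le. unfold Rdiv. rewrite Rabs_mult, <- RPow_abs, Rabs_inv.
    rewrite (Rabs_pos_eq (INR (S n) * _))
      by (left; apply Rmult_lt_0_compat; [apply hq | apply INR_fact_lt_0]).
    pose proof (hq n). pose proof (INR_fact_neq_0 (S n)). field. split; [assumption | lra].
Qed.

Lemma Derive_Wi (beta x : R) :
  noninteger beta ->
  Derive (fun alpha => Wi alpha beta x) 1 =
  digamma beta / Gamma beta -
  (digamma beta * PSeries (hyp0F1 beta) x +
   PSeries (fun n => harmonic beta n * hyp0F1 beta n) x) / Gamma beta.
Proof.
  intros hb. pose proof (noninteger_nonpole beta hb) as hz.
  pose proof (Gamma_neq_0 beta hz) as hG.
  transitivity (Series (fun n => - (x ^ S n / INR (fact (S n)) *
       (digamma (beta + INR (S n)) / Gamma (beta + INR (S n))))));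
    [apply is_derive_unique; now apply is_derive_Wi |].
  set (c := PS_plus (PS_scal (digamma beta) (hyp0F1 beta))
                    (fun n => harmonic beta n * hyp0F1 beta n)).
  assert (hc : entire c) by
    (unfold c; auto using entire_plus, entire_scal, entire_hyp0F1, entire_harmonic).
  replace (digamma beta * PSeries (hyp0F1 beta) x +
   PSeries (fun n => harmonic beta n * hyp0F1 beta n) x) with (PSeries c x).
  2:{ unfold c. rewrite PSeries_PS_plus, PSeries_scal
        by auto using entire_scal, entire_hyp0F1, entire_harmonic. reflexivity. }
  unfold PSeries.
  rewrite (Series_incr_1 (fun k => c k * x ^ k)) by now apply entire_ex_series.
  rewrite (Series_ext _ (fun n => - / Gamma beta * (c (S n) * x ^ S n))).
  - rewrite Series_scal_l.
    assert (c0 : c O = digamma beta).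
    { unfold c, PS_plus, PS_scal, plus, scal, hyp0F1; simpl; unfold mult; simpl. field. }
    rewrite c0, pow_O. field. exact hG.
  - intros n. rewrite digamma_plus_INR, Gamma_plus_INR by exact hz.
    unfold c, PS_plus, PS_scal, plus, scal; cbn [AbelianMonoid.plus]; simpl plus.
    unfold hyp0F1.
    pose proof (nonpole_poch beta (S n) hz). pose proof (INR_fact_neq_0 (S n)).
    change (- (x ^ S n / INR (fact (S n)) * ((digamma beta + harmonic beta (S n)) /
       (poch beta (S n) * Gamma beta))) =
      - / Gamma beta * ((digamma beta * / (INR (fact (S n)) * poch beta (S n)) +
        harmonic beta (S n) * / (INR (fact (S n)) * poch beta (S n))) * x ^ S n)).
    field. auto.
Qed.

(** * Principal branches and the reduction formula *)

Definition polar (r phi : R) : C := (RtoC r * (cos phi, sin phi))%C.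

Lemma polar_mult (r s phi psi : R) :
  (polar r phi * polar s psi)%C = polar (r * s) (phi + psi).
Proof.
  unfold polar. rewrite cos_plus, sin_plus. apply injective_projections; simpl; ring.
Qed.

Lemma Cmod_polar (r phi : R) : 0 < r -> Cmod (polar r phi) = r.
Proof.
  intros hr. unfold polar. rewrite Cmod_mult, Cmod_R, Rabs_pos_eq by lra.
  unfold Cmod. simpl fst. simpl snd.
  rewrite Rplus_comm, <- !Rsqr_pow2, sin2_cos2, sqrt_1. ring.
Qed.

Lemma Carg_polar (r phi : R) : 0 < r -> 0 <= phi <= PI -> Carg (polar r phi) = phi.
Proof.
  intros hr hphi. unfold Carg. rewrite Cmod_polar by exact hr.
  assert (e1 : Re (polar r phi) = r * cos phi) by (unfold polar; simpl; ring).
  assert (e2 : Im (polar r phi) = r * sin phi) by (unfold polar; simpl; ring).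
  rewrite e1, e2. pose proof (sin_ge_0 phi (proj1 hphi) (proj2 hphi)).
  destruct (Rlt_dec (r * sin phi) 0) as [h | _].
  - pose proof (Rmult_le_pos r (sin phi)). lra.
  - replace (r * cos phi / r) with (cos phi) by (field; lra). now apply acos_cos.
Qed.

(** The hypothesis on phi keeps the argument inside the range of the principal
    branch. *)
Lemma Cpower_polar (r phi s : R) :
  0 < r -> 0 <= phi <= PI -> Cpower (polar r phi) s = polar (Rpower r s) (s * phi).
Proof. intros hr hphi. unfold Cpower. now rewrite Cmod_polar, Carg_polar. Qed.

Lemma RtoC_polar (x : R) :
  x <> 0 -> exists phi, 0 <= phi <= PI /\ RtoC x = polar (Rabs x) phi.
Proof.
  intros hx. pose proof PI_RGT_0. destruct (Rle_or_lt 0 x) as [h | h].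
  - exists 0. split; [lra |]. rewrite Rabs_pos_eq by exact h.
    unfold polar. rewrite cos_0, sin_0. apply injective_projections; simpl; ring.
  - exists PI. split; [lra |]. rewrite Rabs_left by exact h.
    unfold polar. rewrite cos_PI, sin_PI. apply injective_projections; simpl; ring.
Qed.

Lemma Csqrt_polar (r phi : R) :
  0 < r -> 0 <= phi <= PI -> Csqrt (polar r phi) = polar (Rpower r (1 / 2)) (1 / 2 * phi).
Proof. apply Cpower_polar. Qed.

Lemma Csqrt_square (x : R) : x <> 0 -> (Csqrt (RtoC x) * Csqrt (RtoC x))%C = RtoC x.
Proof.
  intros hx. destruct (RtoC_polar x hx) as [phi [hphi e]].
  rewrite e, Csqrt_polar by (try apply Rabs_pos_lt; assumption).
  rewrite polar_mult, <- Rpower_plus. f_equal; [| field].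
  replace (1 / 2 + 1 / 2) with 1 by field. apply Rpower_1. now apply Rabs_pos_lt.
Qed.

(** The square root has argument phi / 2, again in [0, PI], so the two principal
    powers combine by adding exponents of the same x. *)
Lemma Cpower_Csqrt (x s nu : R) :
  x <> 0 ->
  exists phi, RtoC x = polar (Rabs x) phi /\
  (Cpower (RtoC x) s * Cpower (Csqrt (RtoC x)) nu)%C =
  polar (Rpower (Rabs x) (s + nu / 2)) ((s + nu / 2) * phi).
Proof.
  intros hx. destruct (RtoC_polar x hx) as [phi [hphi e]]. exists phi. split; [exact e |].
  pose proof (Rabs_pos_lt x hx) as hr.
  rewrite e, Csqrt_polar, !Cpower_polar by (try apply exp_pos; try assumption; lra).
  rewrite polar_mult, Rpower_mult, <- Rpower_plus. f_equal; [f_equal |]; field.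
Qed.

(** (2 sqrt x)^2 / 4 = x, so the series of the Bessel function is a real 0F1 and
    only its prefactor depends on a branch. *)
Lemma besselI_Csqrt (nu x : R) :
  x <> 0 -> nonpole (nu + 1) ->
  besselI nu (2 * Csqrt (RtoC x)) =
  (Cpower (Csqrt (RtoC x)) nu *
   RtoC (PSeries (hyp0F1 (nu + 1)) x / Gamma (nu + 1)))%C.
Proof.
  intros hx hz. unfold besselI.
  assert (two : RtoC 2 <> 0%C) by (intros e; apply RtoC_inj in e; lra).
  replace (2 * Csqrt (RtoC x) / 2)%C with (Csqrt (RtoC x)) by (field; exact two).
  f_equal.
  assert (e : (2 * Csqrt (RtoC x) * (2 * Csqrt (RtoC x)) / 4)%C = RtoC x).
  { rewrite <- (Csqrt_square x hx) at 3.
    replace (RtoC 4) with (RtoC 2 * RtoC 2)%C by (rewrite <- RtoC_mult; f_equal; ring).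
    now field. }
  rewrite e.
  assert (et : forall k, ((RtoC x) ^ k / RtoC (INR (fact k) * Gamma (nu + INR k + 1)))%C =
    RtoC (/ Gamma (nu + 1) * (hyp0F1 (nu + 1) k * x ^ k))).
  { intros k.
    replace (nu + INR k + 1) with (nu + 1 + INR k) by ring.
    rewrite Gamma_plus_INR by exact hz.
    pose proof (Gamma_neq_0 _ hz). pose proof (nonpole_poch _ k hz).
    pose proof (INR_fact_neq_0 k).
    rewrite <- RtoC_pow, <- RtoC_div.
    - f_equal. unfold hyp0F1. field. auto.
    - auto using Rmult_integral_contrapositive_currified. }
  unfold CSeries.
  rewrite (Series_ext _ (fun k => / Gamma (nu + 1) * (hyp0F1 (nu + 1) k * x ^ k)))
    by (intros k; now rewrite et).
  rewrite (Series_ext (fun k => Im _) (fun k => 0 * 1 ^ k))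
    by (intros k; rewrite et; simpl; ring).
  fold (PSeries (fun _ => 0) 1). rewrite PSeries_const_0, Series_scal_l.
  unfold RtoC, PSeries. f_equal. unfold Rdiv. ring.
Qed.

(** The exponents of x add up to 0. *)
Lemma bessel_first_factor (beta x : R) :
  x <> 0 -> nonpole beta ->
  (Cpower (RtoC x) ((1 - beta) / 2)%R * besselI (beta - 1)%R (2 * Csqrt (RtoC x)))%C =
  RtoC (PSeries (hyp0F1 beta) x / Gamma beta).
Proof.
  intros hx hz.
  assert (e : beta - 1 + 1 = beta) by ring.
  rewrite besselI_Csqrt, e by (try rewrite e; assumption).
  rewrite Cmult_assoc.
  destruct (Cpower_Csqrt x ((1 - beta) / 2) (beta - 1) hx) as [phi [_ ep]].
  rewrite ep. replace ((1 - beta) / 2 + (beta - 1) / 2) with 0 by field.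
  rewrite Rmult_0_l, Rpower_O by now apply Rabs_pos_lt.
  unfold polar. rewrite cos_0, sin_0. apply injective_projections; simpl; ring.
Qed.

(** The exponents of x add up to 1. *)
Lemma bessel_second_factor (beta x : R) :
  x <> 0 -> nonpole (2 - beta) ->
  (Cpower (RtoC x) ((1 + beta) / 2)%R * besselI (1 - beta)%R (2 * Csqrt (RtoC x)))%C =
  RtoC (x * (PSeries (hyp0F1 (2 - beta)) x / Gamma (2 - beta))).
Proof.
  intros hx hz.
  assert (e : 1 - beta + 1 = 2 - beta) by ring.
  rewrite besselI_Csqrt, e by (try rewrite e; assumption).
  rewrite Cmult_assoc.
  destruct (Cpower_Csqrt x ((1 + beta) / 2) (1 - beta) hx) as [phi [e1 ep]].
  rewrite ep. replace ((1 + beta) / 2 + (1 - beta) / 2) with 1 by field.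
  rewrite Rmult_1_l, Rpower_1 by now apply Rabs_pos_lt.
  now rewrite <- e1, <- RtoC_mult.
Qed.

Theorem theorem3p1 (beta x : R)
    (hbeta : forall m : Z, beta <> IZR m) (hx : x <> 0) :
  ex_derive (fun alpha => Wi alpha beta x) 1 /\
  RtoC (Derive (fun alpha => Wi alpha beta x) 1) =
  (RtoC (digamma beta / Gamma beta)%R
   - Cpower (RtoC x) ((1 - beta) / 2)%R * besselI (beta - 1)%R (2 * Csqrt (RtoC x))
     * RtoC (digamma beta
             + x / (beta * (beta - 1))
               * pFq [1; 1; 3 / 2] [2; 2; 1 + beta; 2 - beta] (4 * x))%R
   - RtoC (Gamma (1 - beta) / (beta * Gamma (1 + beta)))%R
     * Cpower (RtoC x) ((1 + beta) / 2)%R * besselI (1 - beta)%R (2 * Csqrt (RtoC x))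
     * RtoC (pFq_at (fun b => [b; 1 / 2 + b])
                    (fun b => [2 * b; 1 + b; 1 + b]) beta (4 * x))%R)%C.
Proof.
  pose proof (noninteger_nonpole beta hbeta) as hz.
  pose proof (noninteger_2_minus beta hbeta) as hb2.
  pose proof (noninteger_nonpole _ hb2) as hz2.
  assert (hz1 : nonpole (1 - beta)).
  { apply noninteger_nonpole. replace (1 - beta) with (2 - beta + IZR (-1)) by (simpl; ring).
    now apply noninteger_shift. }
  split; [eexists; now apply is_derive_Wi |].
  rewrite Derive_Wi by exact hbeta.
  rewrite bessel_first_factor by assumption.
  rewrite <- (Cmult_assoc (RtoC (Gamma (1 - beta) / _))), bessel_second_factor by assumption.
  rewrite pFq_at_coef2F3, <- PSeries_coefP by exact hbeta.
  rewrite <- !RtoC_mult, <- !RtoC_minus. f_equal.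
  rewrite (PSeries_ext _ _ x (fun n => harmonic_variation_of_parameters beta n hbeta)).
  rewrite PSeries_PS_plus, !PSeries_PS_mult
    by auto using entire_mult, entire_hyp0F1, entire_coefP, entire_coefQ.
  rewrite (PSeries_coefQ beta x hbeta).
  rewrite (Rplus_comm 1 beta), (Gamma_succ beta hz).
  replace (Gamma (2 - beta)) with ((1 - beta) * Gamma (1 - beta))
    by (rewrite <- Gamma_succ by exact hz1; f_equal; ring).
  pose proof (Gamma_neq_0 _ hz). pose proof (Gamma_neq_0 _ hz1).
  pose proof (nonpole_neq_0 _ hz). pose proof (nonpole_neq_0 _ hz1).
  field. auto.
Qed.
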